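(* Let $x_1,\dots,x_M\in\mathbb R^N$ be data points, $\hat\mu\in\mathbb R^N$ and $\hat\Sigma\in\mathbb S_{++}^N$ the empirical mean and covariance, and $\rho_1,\rho_2>0$. Consider minimizing $$f(\mu,\Sigma)=\Big\langle M^{-1}\sum_{j=1}^M(x_j-\mu)(x_j-\mu)^T,\ \Sigma^{-1}\Big\rangle+\log\det\Sigma$$ over $\boldsymbol\Theta=\Theta^{(1)}\times\Theta^{(2)}$, where $\Theta^{(1)}=\{\mu\in\mathbb R^N:(\mu-\hat\mu)^T(\mu-\hat\mu)\le\rho_1^2\}$ and $\Theta^{(2)}=\{\Sigma\in\mathbb S_{++}^N:d(\Sigma,\hat\Sigma)\le\rho_2\}$. Let $\lambda>0$ and let $\boldsymbol\theta_n=(\mu_n,\Sigma_n)$ be generated, from an arbitrary initialization $\boldsymbol\theta_0\in\boldsymbol\Theta$, by $$\mu_n\in\operatorname*{arg\,min}_{\mu\in\Theta^{(1)}}\Big\{f(\mu,\Sigma_{n-1})+\frac\lambda2\|\mu-\mu_{n-1}\|^2\Big\},$$ $$\Sigma_n\in\operatorname*{arg\,min}_{\Sigma\in\Theta^{(2)}}\Big\{f(\mu_n,\Sigma)+\frac\lambda4\Big\|\log\big(\Sigma_{n-1}^{-1/2}\Sigma\Sigma_{n-1}^{-1/2}\big)\Big\|_F^2\Big\}.$$ Then the limit points of $(\boldsymbol\theta_n)_n$ are stationary points of the problem of minimizing $f$ over $\boldsymbol\Theta$. Furthermore, the worst-case iteration complexity is $N_\varepsilon=\widetilde O(\varepsi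lon^{-2})$.
   Context: $\mathbb S_{++}^N$ is the manifold of symmetric positive definite $N\times N$ matrices with the Fisher–Rao metric $\langle\Omega_1,\Omega_2\rangle_\Sigma=\frac12\operatorname{Tr}(\Omega_1\Sigma^{-1}\Omega_2\Sigma^{-1})$, a Hadamard manifold, with geodesic distance $d(\Sigma_0,\Sigma_1)=\frac1{\sqrt2}\|\log(\Sigma_1^{-1/2}\Sigma_0\Sigma_1^{-1/2})\|_F$ ($\log$ is the matrix logarithm). $\mathbb R^N$ carries the Euclidean metric. Let $\mathcal M^{(1)}=\mathbb R^N$, $\mathcal M^{(2)}=\mathbb S_{++}^N$; both have infinite injectivity radius, so any fixed $r_0>0$ is a lower bound for it. For $x\in\Theta^{(i)}$ let $T_x^*=\{u\in T_x\mathcal M^{(i)}:\mathrm{Exp}_x(u)=x'\text{ for some }x'\in\Theta^{(i)}\text{ with }d(x,x')\le r_0/2\}$. A point $\boldsymbol\theta_*=(\theta_*^{(1)},\theta_*^{(2)})\in\boldsymbol\Theta$ is $\varepsilon$-stationary if $\sum_{i=1}^2\big(-\inf_{u\in T^*_{\theta_*^{(i)}},\|u\|\le1}\langle\mathrm{grad}_if(\boldsymbol\theta_* ),u/\min\{r_0,1\}\rangle\big)\le\varepsilon$, where $\mathrm{grad}_i$ is the Riemannian gradient in block $i$; it is stationary if this holds with $\varepsilon=0$. $N_\varepsilon=\sup_{\boldsymbol\theta_0\in\boldsymbol\Theta}\inf\{n\ge1:\boldsymbol\theta_n\text{ is }\varepsilon\text{-stationary}\}$, and $\widetilde O(\cdot)$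 means $O(\cdot)$ as $\varepsilon\to0^+$ up to logarithmic factors. *)

(* Defs.v *)
From mathcomp Require Export all_boot all_order all_algebra.
From mathcomp Require Export all_classical all_reals all_analysis.
Export Order.TTheory GRing.Theory Num.Theory numFieldNormedType.Exports.

Set Implicit Arguments.
Unset Strict Implicit.
Unset Printing Implicit Defensive.

Local Open Scope classical_set_scope.
Local Open Scope ring_scope.

Section MatrixFunctions.
Context {R : realType} {N : nat}.
Implicit Types A B : 'M[R]_N.

Definition spd : set 'M[R]_N :=
  [set A | A^T = A /\ forall v : 'cV[R]_N, v != 0 -> 0 < \tr (v^T *m A *m v)].

Definition mxdot A B : R := \tr (A^T *m B).

Definition frob A : R := Num.sqrt (mxdot A A).

Definition expm A : 'M[R]_N :=
  limn (series (fun k : nat => k`!%:R^-1 *: A ^+ k)).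

(* On [spd], the [xget] in [logm] and [sqrtm] selects the unique element of the
   set; both functions take the value 0 when there is no such element. *)
Definition logm A : 'M[R]_N := xget 0 [set L | L^T = L /\ expm L = A].

Definition sqrtm A : 'M[R]_N := xget 0 [set B | spd B /\ B *m B = A].

Definition isqrtm A : 'M[R]_N := invmx (sqrtm A).

End MatrixFunctions.

Section Manifolds.
Context {R : realType}.

(* Riemannian data on an open subset of a linear subspace of [V]: the tangent
   space at every point is identified with that subspace, so that the
   differential of [h] at [x] along a tangent vector [v] is ['D_v h x].  The
   fields are only meaningful at points of the manifold. *)
Record riemannian (V : normedModType R) := Riemannian {
  tangent : V -> set V ;
  metric : V -> V -> V -> R ;
  Exp : V -> V -> V ;
  gdist : V -> V -> R }.

Definition rnorm (V : normedModType R) (g : riemannian V) (x u : V) : R :=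
  Num.sqrt (metric g x u u).

Definition rgrad (V : normedModType R) (g : riemannian V) (h : V -> R) (x : V) :
    V :=
  xget 0 [set G | tangent g x G /\
    forall v, tangent g x v -> metric g x G v = 'D_v (h : V -> R^o) x].

Definition euclidean (N : nat) : riemannian 'cV[R]_N := {|
  tangent := fun _ => setT ;
  metric := fun _ u v => \tr (u^T *m v) ;
  Exp := fun x u => x + u ;
  gdist := fun x y => Num.sqrt (\tr ((x - y)^T *m (x - y))) |}.

(* The Fisher-Rao geodesic issued from S with velocity u is
   t |-> S^(1/2) exp(t S^(-1/2) u S^(-1/2)) S^(1/2). *)
Definition fisher_rao (N : nat) : riemannian 'M[R]_N := {|
  tangent := fun _ => [set u | u^T = u] ;
  metric := fun S u v => 2^-1 * \tr (u *m invmx S *m v *m invmx S) ;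
  Exp := fun S u =>
    sqrtm S *m expm (isqrtm S *m u *m isqrtm S) *m sqrtm S ;
  gdist := fun S0 S1 =>
    (Num.sqrt 2)^-1 * frob (logm (isqrtm S1 *m S0 *m isqrtm S1)) |}.

Definition Tstar (V : normedModType R) (g : riemannian V) (Theta : set V)
    (r0 : R) (x : V) : set V :=
  [set u | tangent g x u /\
    exists2 x', Theta x' & Exp g x u = x' /\ gdist g x x' <= r0 / 2].

(* For x in Theta the infimum is that of a set of reals which contains 0
   (take u = 0) and is bounded below. *)
Definition block_gap (V : normedModType R) (g : riemannian V) (Theta : set V)
    (r0 : R) (h : V -> R) (x : V) : R :=
  - inf [set metric g x (rgrad g h x) ((Num.min r0 1)^-1 *: u) | u in
          [set u | Tstar g Theta r0 x u /\ rnorm g x u <= 1]].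

Definition eps_stationary (V1 V2 : normedModType R)
    (g1 : riemannian V1) (g2 : riemannian V2)
    (Theta1 : set V1) (Theta2 : set V2) (r0 : R) (f : V1 -> V2 -> R) (eps : R) :
    set (V1 * V2) :=
  [set t | (Theta1 `*` Theta2) t /\
    block_gap g1 Theta1 r0 (fun x => f x t.2) t.1
    + block_gap g2 Theta2 r0 (fun y => f t.1 y) t.2 <= eps].

End Manifolds.

Definition argmin {R : realType} {T : Type} (A : set T) (h : T -> R) : set T :=
  [set t | A t /\ forall s, A s -> h t <= h s].

(* g(eps) = O~(h(eps)) as eps -> 0+. *)
Definition soft_bigO {R : realType} (g : R -> \bar R) (h : R -> R) : Prop :=
  exists (C : R) (k : nat),
    \forall eps \near 0^'+, (g eps <= (C * h eps * ln eps^-1 ^+ k)%:E)%E.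

Section Problem.
Context {R : realType} {N M : nat}.
Variable x : 'I_M -> 'cV[R]_N.

Definition scatter (mu : 'cV[R]_N) : 'M[R]_N :=
  M%:R^-1 *: \sum_(j < M) (x j - mu) *m (x j - mu)^T.

Definition emp_mean : 'cV[R]_N := M%:R^-1 *: \sum_(j < M) x j.

Definition emp_cov : 'M[R]_N := scatter emp_mean.

Definition objective (mu : 'cV[R]_N) (S : 'M[R]_N) : R :=
  mxdot (scatter mu) (invmx S) + ln (\det S).

Definition Theta1 (rho1 : R) : set 'cV[R]_N :=
  [set mu | \tr ((mu - emp_mean)^T *m (mu - emp_mean)) <= rho1 ^+ 2].

Definition Theta2 (rho2 : R) : set 'M[R]_N :=
  [set S | spd S /\ gdist (fisher_rao N) S emp_cov <= rho2].

Definition iterates (rho1 rho2 lambda : R) :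
    set (nat -> 'cV[R]_N * 'M[R]_N) :=
  [set theta | (Theta1 rho1 `*` Theta2 rho2) (theta 0%N) /\
    forall n,
      argmin (Theta1 rho1)
        (fun mu => objective mu (theta n).2
           + lambda / 2 * \tr ((mu - (theta n).1)^T *m (mu - (theta n).1)))
        (theta n.+1).1 /\
      argmin (Theta2 rho2)
        (fun S => objective (theta n.+1).1 S
           + lambda / 4 * frob (logm (isqrtm (theta n).2 *m S
                                        *m isqrtm (theta n).2)) ^+ 2)
        (theta n.+1).2].

Definition eps_stationary_pt (rho1 rho2 r0 eps : R) :
    set ('cV[R]_N * 'M[R]_N) :=
  eps_stationary (euclidean N) (fisher_rao N) (Theta1 rho1) (Theta2 rho2) r0
    objective eps.

Local Open Scope ereal_scope.

Definition hitting_time (rho1 rho2 r0 : R) (theta : nat -> 'cV[R]_N * 'M[R]_N)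
    (eps : R) : \bar R :=
  ereal_inf [set n%:R%:E | n in
    [set n | (1 <= n)%N /\ eps_stationary_pt rho1 rho2 r0 eps (theta n)]].

(* The supremum ranges over all initializations theta 0 in Theta1 x Theta2 and
   all choices of minimizers. *)
Definition complexity (rho1 rho2 lambda r0 eps : R) : \bar R :=
  ereal_sup [set hitting_time rho1 rho2 r0 theta eps |
              theta in iterates rho1 rho2 lambda].

End Problem.

(* Main.v *)
From mathcomp Require Import spectral complex.
Require Import Defs.
From mathcomp Require Import lra ring.

(** The theorem rests on one estimate.  Let q be produced from p by one pass of
    the algorithm, and let s be the size of this step, that is
    |mu_q - mu_p| + |log (S_p^(-1/2) S_q S_p^(-1/2))|.  Then the stationarity
    gap of q is at most C s, with a constant C that does not depend on p and q
    ([stationarity_gap_le]).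

    Each pass decreases the objective by at least a fixed multiple of s^2
    ([descent]) and the objective is bounded on the feasible set, so the squared
    step sizes of a run have a bounded sum.  Among the first K steps one is
    therefore O(K^(-1/2)), which gives the complexity O(eps^-2), even without
    logarithms ([complexity_bound]).  At a limit point p the step sizes tend to
    zero, so the minimality of the iterates passes to the limit and says that p
    is produced from itself by one pass ([limit_prox_step]); the estimate with
    s = 0 is stationarity.

    The estimate is a first-order optimality condition in each block.  For the
    mean, the feasible set is a convex ball of a vector space.  For the
    covariance, an admissible velocity u at S is one whose geodesic ends in the
    geodesic ball, and the point is that u does not leave the ball to first
    order.  This is the law of cosines of nonpositive curvature ([cosine_law]),
    where |log X|^2 is, up to a factor, the squared distance from X to the
    identity.  Once it is known, geodesics can be forgotten: the straight
    segments S + t (u - eps e), with e the radial direction, stay in the ball for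
    small t > 0, and minimality along them followed by eps -> 0 gives the
    condition ([prox_first_order]).

    Logarithms of noncommuting matrices are compared through the spectral
    theorem.  If x_i and y_j are the eigenvalues of the symmetric matrices A and
    B, then tr (a(A) b(B)) is the sum of p_ij a(x_i) b(y_j), with weights
    p_ij >= 0 that do not depend on the functions a and b ([mixed_trace]).
    Scalar inequalities between x_i and y_j thus become inequalities between
    traces: Lipschitz bounds, second-order Taylor bounds, monotonicity of the
    logarithm.  For the law of cosines, write gamma(t) = G e^(t w) G^T.  The
    matrix W = gamma^-1 gamma' is constant in t, the derivative of
    |log gamma|^2 is 2 F with F = tr (log gamma W), and F is nondecreasing
    because the logarithm is monotone.  Both facts are used as one-step
    inequalities with an error O(d^2) and added along a subdivision of step d
    ([convex_from_local]), so that no derivative of the matrix logarithm is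
    needed. *)

Set Implicit Arguments.
Unset Strict Implicit.
Unset Printing Implicit Defensive.

Local Open Scope classical_set_scope.
Local Open Scope ring_scope.

(** * Euclidean geometry of matrices *)

Section Euclid.
Context {R : realType}.

Definition fdot {m n} (A B : 'M[R]_(m, n)) : R := \tr (A^T *m B).
Definition fnorm {m n} (A : 'M[R]_(m, n)) : R := Num.sqrt (fdot A A).

Lemma fdotE m n (A B : 'M[R]_(m, n)) : fdot A B = \sum_i \sum_j A i j * B i j.
Proof.
rewrite /fdot /mxtrace exchange_big; apply: eq_bigr => j _.
by rewrite mxE; apply: eq_bigr => i _; rewrite mxE.
Qed.

Lemma fdotC m n (A B : 'M[R]_(m, n)) : fdot A B = fdot B A.
Proof. by rewrite /fdot -mxtrace_tr trmx_mul trmxK. Qed.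

Lemma fdotDr m n (A B C : 'M[R]_(m, n)) : fdot A (B + C) = fdot A B + fdot A C.
Proof. by rewrite /fdot mulmxDr mxtraceD. Qed.

Lemma fdotZr m n a (A B : 'M[R]_(m, n)) : fdot A (a *: B) = a * fdot A B.
Proof. by rewrite /fdot -scalemxAr mxtraceZ. Qed.

Lemma fdotNr m n (A B : 'M[R]_(m, n)) : fdot A (- B) = - fdot A B.
Proof. by rewrite -scaleN1r fdotZr mulN1r. Qed.

Lemma fdotBr m n (A B C : 'M[R]_(m, n)) : fdot A (B - C) = fdot A B - fdot A C.
Proof. by rewrite fdotDr fdotNr. Qed.

Lemma fdotDl m n (A B C : 'M[R]_(m, n)) : fdot (A + B) C = fdot A C + fdot B C.
Proof. by rewrite fdotC fdotDr !(fdotC C). Qed.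

Lemma fdotZl m n a (A B : 'M[R]_(m, n)) : fdot (a *: A) B = a * fdot A B.
Proof. by rewrite fdotC fdotZr fdotC. Qed.

Lemma fdotNl m n (A B : 'M[R]_(m, n)) : fdot (- A) B = - fdot A B.
Proof. by rewrite fdotC fdotNr fdotC. Qed.

Lemma fdotBl m n (A B C : 'M[R]_(m, n)) : fdot (A - B) C = fdot A C - fdot B C.
Proof. by rewrite fdotDl fdotNl. Qed.

Lemma fdot_ge0 m n (A : 'M[R]_(m, n)) : 0 <= fdot A A.
Proof.
by rewrite fdotE; apply: sumr_ge0 => i _; apply: sumr_ge0 => j _; rewrite -expr2 sqr_ge0.
Qed.

Lemma fdot_eq0 m n (A : 'M[R]_(m, n)) : fdot A A = 0 -> A = 0.
Proof.
rewrite fdotE => /eqP; rewrite psumr_eq0; last first.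
  by move=> i _; apply: sumr_ge0 => j _; rewrite -expr2 sqr_ge0.
move=> /allP h; apply/matrixP => i j; rewrite mxE.
have /= := h i (mem_index_enum i); rewrite psumr_eq0; last by move=> k _; rewrite -expr2 sqr_ge0.
by move=> /allP /(_ j (mem_index_enum j)) /=; rewrite -expr2 sqrf_eq0 => /eqP.
Qed.

Lemma fnorm_ge0 m n (A : 'M[R]_(m, n)) : 0 <= fnorm A.
Proof. exact: sqrtr_ge0. Qed.

Lemma sqr_fnorm m n (A : 'M[R]_(m, n)) : fnorm A ^+ 2 = fdot A A.
Proof. by rewrite sqr_sqrtr ?fdot_ge0. Qed.

Lemma fnorm0 m n : fnorm (0 : 'M[R]_(m, n)) = 0.
Proof. by rewrite /fnorm /fdot mulmx0 mxtrace0 sqrtr0. Qed.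

Lemma fnormZ m n a (A : 'M[R]_(m, n)) : fnorm (a *: A) = `|a| * fnorm A.
Proof. by rewrite /fnorm fdotZl fdotZr mulrA -expr2 sqrtrM ?sqr_ge0// sqrtr_sqr. Qed.

Lemma fnormN m n (A : 'M[R]_(m, n)) : fnorm (- A) = fnorm A.
Proof. by rewrite -scaleN1r fnormZ normrN1 mul1r. Qed.

Lemma fnorm_tr m n (A : 'M[R]_(m, n)) : fnorm A^T = fnorm A.
Proof. by rewrite /fnorm /fdot trmxK mxtrace_mulC. Qed.

Lemma fdot_sqr_le m n (A B : 'M[R]_(m, n)) : fdot A B ^+ 2 <= fdot A A * fdot B B.
Proof.
have [/fdot_eq0 ->|B0] := eqVneq (fdot B B) 0.
  by rewrite /fdot mulmx0 mxtrace0 expr0n mulr_ge0// fdot_ge0.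
have B_gt0 : 0 < fdot B B by rewrite lt_def B0 fdot_ge0.
have := fdot_ge0 (fdot B B *: A - fdot A B *: B).
rewrite fdotBl !fdotBr !fdotZl !fdotZr (fdotC B A).
set a := fdot A A; set b := fdot B B; set c := fdot A B => h.
by rewrite -subr_ge0 -(pmulr_rge0 _ B_gt0); move: h; congr (_ <= _); rewrite -/b; ring.
Qed.

Lemma cauchy_schwarz m n (A B : 'M[R]_(m, n)) : `|fdot A B| <= fnorm A * fnorm B.
Proof.
rewrite -sqrtrM ?fdot_ge0// -sqrtr_sqr ler_sqrt ?fdot_sqr_le//.
by rewrite mulr_ge0 ?fdot_ge0.
Qed.

Lemma fnormD m n (A B : 'M[R]_(m, n)) : fnorm (A + B) <= fnorm A + fnorm B.
Proof.
rewrite -(@ler_pXn2r _ 2)// ?nnegrE ?addr_ge0 ?fnorm_ge0//.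
rewrite sqrrD !sqr_fnorm fdotDl !fdotDr (fdotC B A).
have := cauchy_schwarz A B; rewrite ler_norml => /andP[_ h]; lra.
Qed.

Lemma fnormB m n (A B : 'M[R]_(m, n)) : fnorm (A - B) <= fnorm A + fnorm B.
Proof. by apply: le_trans (fnormD _ _) _; rewrite fnormN. Qed.

Lemma fnormM m n p (A : 'M[R]_(m, n)) (B : 'M[R]_(n, p)) :
  fnorm (A *m B) <= fnorm A * fnorm B.
Proof.
rewrite -sqrtrM ?fdot_ge0// ler_sqrt ?mulr_ge0 ?fdot_ge0//.
rewrite [X in _ <= _ * X](_ : _ = \sum_k fdot (col k B) (col k B)); last first.
  rewrite fdotE exchange_big; apply: eq_bigr => k _; rewrite fdotE.
  by apply: eq_bigr => i _; rewrite big_ord1 mxE.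
rewrite [X in _ <= X * _](_ : _ = \sum_i fdot (row i A)^T (row i A)^T); last first.
  rewrite fdotE; apply: eq_bigr => i _; rewrite fdotE.
  by apply: eq_bigr => j _; rewrite big_ord1 !mxE.
rewrite mulr_suml fdotE; apply: ler_sum => i _.
rewrite mulr_sumr; apply: ler_sum => k _.
apply: le_trans (fdot_sqr_le _ _); rewrite expr2 le_eqVlt; apply/orP; left; apply/eqP.
suff -> : (A *m B) i k = fdot (row i A)^T (col k B) by [].
by rewrite fdotE mxE; apply: eq_bigr => j _; rewrite big_ord1 !mxE.
Qed.

Lemma fdotMl m n p (A : 'M[R]_(m, n)) (B : 'M[R]_(n, p)) C :
  fdot (A *m B) C = fdot B (A^T *m C).
Proof. by rewrite /fdot trmx_mul -mulmxA. Qed.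

Lemma fdotMr m n p (A : 'M[R]_(m, n)) (B : 'M[R]_(n, p)) C :
  fdot (A *m B) C = fdot A (C *m B^T).
Proof. by rewrite /fdot trmx_mul -mulmxA mxtrace_mulC mulmxA. Qed.

End Euclid.

(** * Spectral theorem for real symmetric matrices *)

Section Spectral.
Context {R : realType}.

Lemma diagonal_eigenvalue (F : fieldType) n (P B : 'M[F]_n.+1) (d : 'rV[F]_n.+1) :
  P \in unitmx -> P *m B = diag_mx d *m P -> eigenvalue B (d 0 0).
Proof.
move=> Pu PB; apply/eigenvalueP; exists (row 0 P).
  by rewrite -row_mul PB mul_diag_mx; apply/rowP => j; rewrite !mxE.
apply/eqP => P0; move: Pu; rewrite -row_free_unit => /row_freeP[Q].
move=> /(congr1 (row 0)); rewrite row_mul P0 mul0mx => /rowP /(_ 0).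
by rewrite !mxE eqxx => /eqP; rewrite eq_sym oner_eq0.
Qed.

(** Over R[i] the matrix is Hermitian, hence unitarily diagonalizable with real
    eigenvalues; a real root of the characteristic polynomial has a real
    eigenvector. *)
Lemma symmetric_has_eigenvector n (A : 'M[R]_n.+1) : A^T = A ->
  exists (a : R) (v : 'cV[R]_n.+1), v != 0 /\ A *m v = a *: v.
Proof.
move=> sA; pose B := map_mx (real_complex R) A.
have hB : B \is hermsymmx.
  apply: realsym_hermsym.
    apply/is_hermitianmxP; rewrite expr0 scale1r map_mx_id//.
    by apply/matrixP => i j; rewrite !mxE -{1}sA mxE.
  by apply/mxOverP => i j; rewrite mxE; apply/complex_realP; exists (A i j).
have [P [d [Pu PB [a da]]]] : exists P d, [/\ P \in unitmx,
    P *m B = diag_mx d *m P & exists a : R, d 0 0 = a%:C%C].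
  exists (spectralmx B), (spectral_diag B); split; first exact: spectral_unit.
    have /hermitian_normalmx/orthomx_spectralP BE := hB.
    move: (spectral_unit B) BE; move: (spectralmx B) (spectral_diag B) => P d Pu ->.
    by rewrite !mulmxA mulmxV// mul1mx.
  by have /mxOverP /(_ 0 0)/complex_realP := hermitian_spectral_diag_real hB.
have := diagonal_eigenvalue Pu PB; rewrite da.
rewrite eigenvalue_root_char -map_char_poly fmorph_root -eigenvalue_root_char.
move=> /eigenvalueP[v vA v0]; exists a, v^T; split; last first.
  by rewrite -[in LHS]sA -trmx_mul vA linearZ.
by apply: contra v0 => /eqP/(congr1 trmx); rewrite trmxK trmx0 => ->.
Qed.

Definition orthomx n (Q : 'M[R]_n) := Q^T *m Q = 1%:M.

Lemma orthomx_tr n (Q : 'M[R]_n) : orthomx Q -> Q *m Q^T = 1%:M.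
Proof. exact: mulmx1C. Qed.

(** The Householder reflection that exchanges v / |v| and the first basis vector,
    or the identity if these are equal. *)
Lemma orthomx_first_col n (v : 'cV[R]_n.+1) : v != 0 ->
  exists (Q : 'M[R]_n.+1) (c : R), [/\ orthomx Q, c != 0 & col 0 Q = c *: v].
Proof.
move=> v0; have vv : 0 < fdot v v.
  by rewrite lt_def fdot_ge0 andbT; apply: contra v0 => /eqP/fdot_eq0 ->.
pose e : 'cV[R]_n.+1 := delta_mx 0 0.
pose c := (fnorm v)^-1; have c0 : c != 0 by rewrite invr_neq0// gt_eqF// sqrtr_gt0.
pose w : 'cV[R]_n.+1 := c *: v.
have ww : fdot w w = 1.
  by rewrite fdotZl fdotZr -sqr_fnorm mulrA -expr2 -exprMn mulVf ?expr1n// -invr_eq0.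
have ee : fdot e e = 1.
  by rewrite /fdot /e trmx_delta mul_delta_mx /mxtrace big_ord1 mxE.
have [ew|ew] := eqVneq w e.
  exists 1%:M, c; split => //; first by rewrite /orthomx trmx1 mulmx1.
  by rewrite -/w ew; apply/colP => i; rewrite !mxE eqxx andbT.
pose u : 'cV[R]_n.+1 := w - e.
have uu : fdot u u != 0 by apply: contra ew => /eqP/fdot_eq0/eqP; rewrite subr_eq0.
have uE : fdot u u = 2 - 2 * fdot w e.
  by rewrite fdotBl !fdotBr ww ee (fdotC e w); ring.
pose Q : 'M[R]_n.+1 := 1%:M - (2 / fdot u u) *: (u *m u^T).
have Qt : Q^T = Q by rewrite /Q linearB/= trmx1 linearZ/= trmx_mul trmxK.
have uuM : u^T *m u = (fdot u u)%:M.
  by rewrite [LHS]mx11_scalar /fdot /mxtrace big_ord1.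
exists Q, c; split => //.
  rewrite /orthomx Qt /Q mulmxBl mul1mx mulmxBr mulmx1 -scalemxAr -scalemxAl.
  rewrite mulmxA -(mulmxA u u^T) uuM mul_mx_scalar -!scalemxAl !scalerA.
  rewrite -addrA -opprD -scalerBl -scalerDl.
  have -> : 2 / fdot u u + (2 / fdot u u - 2 / fdot u u * (2 / fdot u u) * fdot u u) = 0 by field.
  by rewrite scale0r subr0.
rewrite -/w colE -/e /Q mulmxBl mul1mx -scalemxAl -mulmxA.
have -> : u^T *m e = (- (fdot u u / 2))%:M.
  rewrite [LHS]mx11_scalar; congr (_%:M).
  have -> : (u^T *m e) 0 0 = fdot u e by rewrite /fdot /mxtrace big_ord1.
  by rewrite uE fdotBl ee; field.
rewrite mul_mx_scalar scalerA.
have -> : 2 / fdot u u * - (fdot u u / 2) = -1 by field.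
by rewrite scaleN1r opprK addrC subrK.
Qed.

(** An eigenvector, moved to the first column by an orthogonal matrix, splits
    off a 1 x 1 block: by symmetry, the rest of the first row vanishes with the
    rest of the first column. *)
Lemma spectral_theorem n (A : 'M[R]_n) : A^T = A ->
  exists (Q : 'M[R]_n) (d : 'rV[R]_n),
    orthomx Q /\ A = Q *m diag_mx d *m Q^T.
Proof.
elim: n A => [|n IHn] A sA.
  exists 1%:M, 0; split; first by rewrite /orthomx trmx1 mul1mx.
  by apply/matrixP => -[].
have [a [v [v0 Av]]] := symmetric_has_eigenvector sA.
have [H [c [oH c0 Hv]]] := orthomx_first_col v0.
pose B : 'M[R]_(1 + n) := H^T *m A *m H.
have sB : B^T = B by rewrite /B !trmx_mul trmxK sA mulmxA.
have B0 : col 0 B = a *: delta_mx 0 0.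
  rewrite colE /B -!mulmxA -colE Hv -scalemxAr Av scalerA mulrC -scalerA -Hv.
  by rewrite -scalemxAr colE mulmxA oH mul1mx.
have Bi0 i (j : 'I_1) : B i (lshift n j) = a * (i == 0)%:R.
  have -> : lshift n j = 0 by apply: val_inj; rewrite /= ord1.
  by have /colP/(_ i) := B0; rewrite ![_ i 0]mxE andbT.
have BE : B = block_mx a%:M 0 0 (drsubmx B).
  have dl : dlsubmx B = 0.
    by apply/matrixP => i j; rewrite [LHS]mxE [LHS]mxE Bi0 mxE mulr0.
  rewrite -[LHS]submxK; congr block_mx => //.
  - by apply/matrixP => i j; rewrite [LHS]mxE [LHS]mxE Bi0 !ord1 mxE mulr1.
  - by rewrite -[RHS]trmx0 -dl trmx_dlsub sB.
have [Q [d [oQ DE]]] := IHn (drsubmx B) ltac:(by rewrite trmx_drsub sB).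
pose K : 'M[R]_(1 + n) := block_mx 1%:M 0 0 Q.
have oK : orthomx K.
  rewrite /orthomx /K tr_block_mx mulmx_block !trmx0 trmx1 !mulmx0 !mul0mx.
  by rewrite mul1mx !addr0 add0r oQ -scalar_mx_block.
have KE : B = K *m diag_mx (row_mx a%:M d) *m K^T.
  rewrite [LHS]BE DE /K tr_block_mx diag_mx_row !mulmx_block !trmx0 trmx1.
  rewrite !mulmx0 !mul0mx !mul1mx !mulmx1 !addr0 !add0r ?mulmxA ?mul0mx ?mulmx0.
  congr block_mx; rewrite ?mul0mx ?mulmx0 //.
  by apply/matrixP => i j; rewrite !ord1 !mxE.
exists (H *m K), (row_mx a%:M d); split.
  by rewrite /orthomx trmx_mul mulmxA -(mulmxA K^T) oH mulmx1.
transitivity (H *m B *m H^T); last by rewrite KE trmx_mul !mulmxA.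
by rewrite /B !mulmxA (orthomx_tr oH) mul1mx -mulmxA (orthomx_tr oH) mulmx1.
Qed.

End Spectral.

(** * Functional calculus and trace inequalities *)

Section FunctionalCalculus.
Context {R : realType}.

Definition spectral_dec n (A : 'M[R]_n) : 'M[R]_n * 'rV[R]_n :=
  xget (1%:M, 0) [set p | orthomx p.1 /\ A = p.1 *m diag_mx p.2 *m p.1^T].

Definition spec n (A : 'M[R]_n) i : R := (spectral_dec A).2 0 i.

(** Locked, so that unification never looks for a product inside [fmx g A]. *)
Definition fmx (g : R -> R) n (A : 'M[R]_n) : 'M[R]_n :=
  locked ((spectral_dec A).1 *m diag_mx (map_mx g (spectral_dec A).2)
    *m (spectral_dec A).1^T).

Lemma spectral_decP n (A : 'M[R]_n) : A^T = A ->
  orthomx (spectral_dec A).1 /\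
  A = (spectral_dec A).1 *m diag_mx (spectral_dec A).2 *m (spectral_dec A).1^T.
Proof.
move=> sA; have [Q [d QD]] := spectral_theorem sA.
by rewrite /spectral_dec; case: xgetP => [[P e] _ []//|/(_ (Q, d))]; case.
Qed.

Lemma tr_conj_diag n (Q : 'M[R]_n) d :
  (Q *m diag_mx d *m Q^T)^T = Q *m diag_mx d *m Q^T.
Proof. by rewrite !trmx_mul trmxK tr_diag_mx mulmxA. Qed.

Lemma mul_conj_diag n (Q : 'M[R]_n) d e : orthomx Q ->
  (Q *m diag_mx d *m Q^T) *m (Q *m diag_mx e *m Q^T) =
  Q *m diag_mx (\row_i (d 0 i * e 0 i)) *m Q^T.
Proof.
move=> oQ; rewrite !mulmxA -(mulmxA _ Q^T Q) oQ mulmx1 -(mulmxA Q).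
by rewrite mulmx_diag.
Qed.

Lemma trace_conj_diag n (Q : 'M[R]_n) d : orthomx Q ->
  \tr (Q *m diag_mx d *m Q^T) = \sum_i d 0 i.
Proof. by move=> oQ; rewrite mxtrace_mulC mulmxA oQ mul1mx mxtrace_diag. Qed.

(** The value does not depend on the diagonalization: if O is the orthogonal
    matrix that relates two of them, O i j is nonzero only between equal
    eigenvalues, where g takes equal values. *)
Lemma fmxE g n (Q : 'M[R]_n) d : orthomx Q ->
  fmx g (Q *m diag_mx d *m Q^T) = Q *m diag_mx (map_mx g d) *m Q^T.
Proof.
move=> oQ; set A := Q *m _ *m _.
have [oP AE] := spectral_decP (tr_conj_diag Q d : A^T = A); rewrite /fmx -!lock.
move: oP AE; set P := (_).1; set e := (_).2 => oP AE.
(* O relates the chosen diagonalization of A to the given one. *)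
pose O := P^T *m Q.
have PO : P *m O = Q by rewrite mulmxA (orthomx_tr oP) mul1mx.
have eO : diag_mx e *m O = O *m diag_mx d.
  have := congr1 (fun X => P^T *m X *m Q) AE; rewrite /A !mulmxA.
  by rewrite oP mul1mx -!mulmxA oQ mulmx1 !mulmxA => <-.
have geO : diag_mx (map_mx g e) *m O = O *m diag_mx (map_mx g d).
  move: (O) eO => {PO}{}O eO; apply/matrixP => i j; move/matrixP/(_ i j): eO.
  rewrite !mul_diag_mx !mul_mx_diag !mxE.
  have [->|Oij] := eqVneq (O i j) 0; first by rewrite !mulr0 !mul0r.
  by rewrite mulrC => /(mulfI Oij) ->; rewrite mulrC.
transitivity (P *m (O *m diag_mx (map_mx g d)) *m Q^T); last by rewrite mulmxA PO.
by rewrite -geO /O -!mulmxA (orthomx_tr oQ) mulmx1.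
Qed.

Lemma tr_fmx g n (A : 'M[R]_n) : (fmx g A)^T = fmx g A.
Proof. by rewrite /fmx -lock tr_conj_diag. Qed.

Lemma eq_fmx g h n (A : 'M[R]_n) :
  (forall i, g (spec A i) = h (spec A i)) -> fmx g A = fmx h A.
Proof.
move=> gh; rewrite /fmx -!lock (_ : map_mx g _ = map_mx h (spectral_dec A).2)//.
by apply/rowP => i; rewrite !mxE -/(spec A i).
Qed.

Lemma fmx_id n (A : 'M[R]_n) : A^T = A -> fmx id A = A.
Proof.
move=> /spectral_decP[_ AE]; by rewrite /fmx -!lock map_mx_id// -AE.
Qed.

Lemma fmxM g h n (A : 'M[R]_n) : A^T = A ->
  fmx g A *m fmx h A = fmx (fun t => g t * h t) A.
Proof.
move=> /spectral_decP[oQ _]; rewrite /fmx -!lock mul_conj_diag//.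
by congr (_ *m diag_mx _ *m _); apply/rowP => i; rewrite !mxE.
Qed.

Lemma fmx_cst c n (A : 'M[R]_n) : A^T = A -> fmx (fun=> c) A = c%:M.
Proof.
move=> /spectral_decP[oQ _]; rewrite /fmx -!lock.
rewrite (_ : map_mx _ _ = const_mx c); last by apply/rowP => i; rewrite !mxE.
by rewrite diag_const_mx mul_mx_scalar -scalemxAl (orthomx_tr oQ) scalemx1.
Qed.

Lemma fmx_comp g h n (A : 'M[R]_n) : A^T = A -> fmx h (fmx g A) = fmx (h \o g) A.
Proof.
move=> /spectral_decP[oQ _]; rewrite {2}/fmx -lock fmxE// /fmx -lock.
by congr (_ *m diag_mx _ *m _); apply/rowP => i; rewrite !mxE.
Qed.

Lemma trace_fmx g n (A : 'M[R]_n) : A^T = A -> \tr (fmx g A) = \sum_i g (spec A i).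
Proof.
move=> /spectral_decP[oQ _]; rewrite /fmx -lock trace_conj_diag//.
by apply: eq_bigr => i _; rewrite mxE.
Qed.

(** Apply the functional calculus to the indicator function of the complement
    of the entries of d: the trace of the result is zero, and it is also the
    number of eigenvalues outside of these entries. *)
Lemma spec_conj_diag n (Q : 'M[R]_n) d i : orthomx Q ->
  exists j, spec (Q *m diag_mx d *m Q^T) i = d 0 j.
Proof.
move=> oQ; set A := Q *m _ *m _; pose g x : R := (~~ [exists j, x == d 0 j])%:R.
have : \tr (fmx g A) = 0.
  rewrite fmxE// trace_conj_diag// big1// => j _; rewrite mxE /g.
  by rewrite (_ : [exists _, _])//; apply/existsP; exists j.
rewrite trace_fmx; last exact: tr_conj_diag.
move/eqP; rewrite psumr_eq0; last by move=> j _; rewrite ler0n.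
move=> /allP/(_ i (mem_index_enum i))/=; rewrite pnatr_eq0 eqb0 negbK.
by move=> /existsP[j /eqP]; exists j.
Qed.

Lemma spec_fmx g n (A : 'M[R]_n) i : A^T = A ->
  exists j, spec (fmx g A) i = g (spec A j).
Proof.
move=> /spectral_decP[oQ _]; have [j] := spec_conj_diag (map_mx g (spectral_dec A).2) i oQ.
by rewrite /fmx -lock mxE; exists j.
Qed.

Lemma det_spec n (A : 'M[R]_n) : A^T = A -> \det A = \prod_i spec A i.
Proof.
move=> /spectral_decP[oQ {1}->]; rewrite !det_mulmx mulrAC -det_mulmx.
by rewrite (orthomx_tr oQ) det1 mul1r det_diag.
Qed.

(** The weights are the squared inner products of the eigenvectors of A with
    those of B.  They do not depend on a and b, so any scalar inequality that
    holds at all pairs of eigenvalues can be integrated against them. *)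
Lemma mixed_trace n (A B : 'M[R]_n) : A^T = A -> B^T = B ->
  exists p : 'I_n -> 'I_n -> R, (forall i j, 0 <= p i j) /\
    forall a b, \tr (fmx a A *m fmx b B) =
      \sum_i \sum_j p i j * (a (spec A i) * b (spec B j)).
Proof.
move=> _ _; pose O := (spectral_dec A).1^T *m (spectral_dec B).1.
exists (fun i j => O i j ^+ 2); split=> [i j|a b]; first exact: sqr_ge0.
transitivity (\tr (diag_mx (map_mx a (spectral_dec A).2) *m O *m
   diag_mx (map_mx b (spectral_dec B).2) *m O^T)).
  by rewrite /fmx -!lock -!mulmxA mxtrace_mulC /O trmx_mul trmxK !mulmxA.
move: (O) => {}O.
apply: eq_bigr => i _; rewrite mxE; apply: eq_bigr => j _.
rewrite mul_mx_diag mul_diag_mx !mxE -/(O i j) /spec; ring.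
Qed.

Lemma fmx_lipschitz g (L : R) n (A B : 'M[R]_n) : A^T = A -> B^T = B -> 0 <= L ->
  (forall i j, `|g (spec A i) - g (spec B j)| <= L * `|spec A i - spec B j|) ->
  fnorm (fmx g A - fmx g B) <= L * fnorm (A - B).
Proof.
move=> sA sB L0 gL.
have [p [p0 pE]] := mixed_trace sA sB.
have key h : fdot (fmx h A - fmx h B) (fmx h A - fmx h B) =
    \sum_i \sum_j p i j * (h (spec A i) - h (spec B j)) ^+ 2.
  have h1 a : \tr (fmx a A) = \sum_i \sum_j p i j * (a (spec A i) * 1).
    by have := pE a (fun=> 1); rewrite (fmx_cst _ sB) mulmx1.
  have h2 b : \tr (fmx b B) = \sum_i \sum_j p i j * (1 * b (spec B j)).
    by have := pE (fun=> 1) b; rewrite (fmx_cst _ sA) mul1mx.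
  rewrite fdotBl !fdotBr (fdotC (fmx h B)) /fdot !tr_fmx !fmxM// h1 h2 pE.
  rewrite -!sumrB; apply: eq_bigr => i _; rewrite -!sumrB; apply: eq_bigr => j _.
  ring.
have := key id; rewrite !fmx_id// => kid.
rewrite -(@ler_pXn2r _ 2)// ?nnegrE ?mulr_ge0 ?fnorm_ge0//.
rewrite exprMn !sqr_fnorm kid key mulr_sumr; apply: ler_sum => i _.
rewrite mulr_sumr; apply: ler_sum => j _; rewrite [leRHS]mulrCA ler_wpM2l//.
rewrite -(real_normK (num_real (g _ - _))) -(real_normK (num_real (_ - spec B j))).
by rewrite -exprMn lerXn2r ?nnegrE ?mulr_ge0.
Qed.

(** Klein's inequality.  Since the weights of [mixed_trace] turn sums over one
    spectrum into sums over pairs, both sides are integrals of the two sides of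
    the scalar inequality. *)
Lemma klein_trace g g' (k : R) n (Y Z : 'M[R]_n) : Y^T = Y -> Z^T = Z ->
  (forall i j, g (spec Z j) <= g (spec Y i) + g' (spec Y i) * (spec Z j - spec Y i)
                               + k * (spec Z j - spec Y i) ^+ 2) ->
  \tr (fmx g Z) <= \tr (fmx g Y) + fdot (fmx g' Y) (Z - Y) + k * fnorm (Z - Y) ^+ 2.
Proof.
move=> sY sZ gk; have [p [p0 pE]] := mixed_trace sY sZ.
have h1 a : \tr (fmx a Y) = \sum_i \sum_j p i j * (a (spec Y i) * 1).
  by have := pE a (fun=> 1); rewrite (fmx_cst _ sZ) mulmx1.
have h2 b : \tr (fmx b Z) = \sum_i \sum_j p i j * (1 * b (spec Z j)).
  by have := pE (fun=> 1) b; rewrite (fmx_cst _ sY) mul1mx.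
have -> : fdot (fmx g' Y) (Z - Y) =
    \tr (fmx g' Y *m fmx id Z) - \tr (fmx (fun t => g' t * t) Y).
  by rewrite -(fmxM _ id)// !fmx_id// /fdot tr_fmx mulmxBr linearB.
have -> : fnorm (Z - Y) ^+ 2 = \tr (fmx (fun t => t * t) Z) -
    2 * \tr (fmx id Y *m fmx id Z) + \tr (fmx (fun t => t * t) Y).
  rewrite sqr_fnorm fdotBl !fdotBr (fdotC Z) -!(fmxM id id)// !fmx_id//.
  by rewrite /fdot sY sZ; ring.
rewrite !h1 !h2 !pE -subr_ge0 !mulr_sumr -!sumrB -!big_split/= mulr_sumr -!big_split/= -sumrB.
apply: sumr_ge0 => i _.
rewrite !mulr_sumr -!sumrB -!big_split/= mulr_sumr -!big_split/= -sumrB.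
apply: sumr_ge0 => j _.
rewrite [leRHS](_ : _ = p i j * (g (spec Y i) + g' (spec Y i) * (spec Z j - spec Y i)
                               + k * (spec Z j - spec Y i) ^+ 2 - g (spec Z j))); last by ring.
by rewrite mulr_ge0// subr_ge0.
Qed.

End FunctionalCalculus.

(** * Exponential, logarithm and square root *)

Section MatrixFunctions.
Context {R : realType}.
Variable n : nat.
Implicit Types (A B L S : 'M[R]_n) (c : R).

Lemma quad_spec A (v : 'cV[R]_n) : A^T = A ->
  \tr (v^T *m A *m v) =
  \sum_i spec A i * (((spectral_dec A).1^T *m v) i 0) ^+ 2.
Proof.
move=> /spectral_decP[oQ AE]; set Q := (spectral_dec A).1.
transitivity (fdot (Q^T *m v) (diag_mx (spectral_dec A).2 *m (Q^T *m v))).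
  by rewrite /fdot trmx_mul trmxK {1}AE !mulmxA.
rewrite fdotE; apply: eq_bigr => i _; rewrite big_ord1.
by rewrite mul_diag_mx [(\matrix_(_, _) _) _ _]mxE /spec; ring.
Qed.

Lemma fdot_spec A (v : 'cV[R]_n) : A^T = A ->
  fdot v v = \sum_i (((spectral_dec A).1^T *m v) i 0) ^+ 2.
Proof.
move=> /spectral_decP[oQ AE]; set Q := (spectral_dec A).1.
transitivity (fdot (Q^T *m v) (Q^T *m v)).
  by rewrite fdotMl trmxK mulmxA (orthomx_tr oQ) mul1mx.
by rewrite fdotE; apply: eq_bigr => i _; rewrite big_ord1 expr2.
Qed.

Lemma spec_eigenvector A i : A^T = A -> exists v : 'cV[R]_n,
  fdot v v = 1 /\ \tr (v^T *m A *m v) = spec A i.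
Proof.
move=> sA; have [oQ AE] := spectral_decP sA; set Q := (spectral_dec A).1.
have QE k : (Q^T *m (Q *m delta_mx i 0)) k 0 = (k == i)%:R :> R.
  by rewrite mulmxA oQ mul1mx mxE andbT.
exists (Q *m delta_mx i 0); rewrite quad_spec// (fdot_spec _ sA).
split; rewrite (bigD1 i)//= QE eqxx ?expr1n ?mulr1 big1 ?addr0// => k ki;
  by rewrite QE (negbTE ki) expr0n ?mulr0.
Qed.

Lemma spec_ge c A : A^T = A ->
  (forall v : 'cV[R]_n, c * fdot v v <= \tr (v^T *m A *m v)) -> forall i, c <= spec A i.
Proof.
move=> sA h i; have [v [v1 <-]] := spec_eigenvector i sA.
by have := h v; rewrite v1 mulr1.
Qed.

Lemma quad_ge c A : A^T = A -> (forall i, c <= spec A i) ->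
  forall v : 'cV[R]_n, c * fdot v v <= \tr (v^T *m A *m v).
Proof.
move=> sA h v; rewrite quad_spec// (fdot_spec _ sA) mulr_sumr.
by apply: ler_sum => i _; rewrite ler_wpM2r ?sqr_ge0.
Qed.

Lemma spd_sym A : spd A -> A^T = A. Proof. by case. Qed.

Lemma spd_spec A : spd A -> forall i, 0 < spec A i.
Proof.
move=> [sA pA] i; have [v [v1 <-]] := spec_eigenvector i sA.
apply: pA; apply/eqP => v0; move: v1; rewrite v0 /fdot mulmx0 mxtrace0.
by move/eqP; rewrite eq_sym oner_eq0.
Qed.

Lemma spec_spd A : A^T = A -> (forall i, 0 < spec A i) -> spd A.
Proof.
move=> sA pA; split=> // v v0.
rewrite quad_spec//; have := fdot_spec v sA; set w := _ *m v => vv.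
have h i : 0 <= spec A i * w i 0 ^+ 2 by rewrite mulr_ge0 ?sqr_ge0// ltW.
rewrite lt_def sumr_ge0// andbT; apply: contra v0 => /eqP/eqP.
rewrite psumr_eq0// => /allP w0; apply/eqP/fdot_eq0; rewrite vv big1// => i _.
have := w0 i (mem_index_enum i); rewrite mulf_eq0 gt_eqF//= => /eqP ->.
by [].
Qed.

Lemma spd_fmx g A : A^T = A -> (forall i, 0 < g (spec A i)) -> spd (fmx g A).
Proof.
move=> sA gA; apply: spec_spd; first exact: tr_fmx.
by move=> i; have [j ->] := spec_fmx g i sA.
Qed.

Lemma spd1 : spd (1%:M : 'M[R]_n).
Proof.
split=> [|v v0]; first by rewrite trmx1.
rewrite mulmx1 -/(fdot v v) lt_def fdot_ge0 andbT.
by apply: contra v0 => /eqP/fdot_eq0 ->.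
Qed.

Lemma spd_congr A B : spd A -> B \in unitmx -> spd (B *m A *m B^T).
Proof.
move=> [sA pA] Bu; split=> [|v v0]; first by rewrite !trmx_mul trmxK sA mulmxA.
have -> : v^T *m (B *m A *m B^T) *m v = (B^T *m v)^T *m A *m (B^T *m v).
  by rewrite trmx_mul trmxK !mulmxA.
apply: pA; apply: contra v0 => /eqP h; rewrite -[v]mul1mx -(@mulVmx _ _ B^T) ?unitmx_tr//.
by rewrite -mulmxA h mulmx0.
Qed.

Lemma fmx_inv A : A^T = A -> (forall i, spec A i != 0) ->
  A \in unitmx /\ invmx A = fmx GRing.inv A.
Proof.
move=> sA nA; have AV : A *m fmx GRing.inv A = 1%:M.
  rewrite -{1}(fmx_id sA) fmxM// -(fmx_cst 1 sA); apply: eq_fmx => i.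
  by rewrite mulfV.
by have [Au _] := mulmx1_unit AV; rewrite -[RHS](mulKmx Au) AV mulmx1.
Qed.

Lemma spd_inv A : spd A -> A \in unitmx /\ invmx A = fmx GRing.inv A.
Proof.
move=> pA; apply: fmx_inv; first exact: spd_sym.
by move=> i; rewrite gt_eqF ?spd_spec.
Qed.

Lemma spd_unit A : spd A -> A \in unitmx. Proof. by case/spd_inv. Qed.

Lemma fmx_pow k A : A^T = A -> A ^+ k = fmx (fun t => t ^+ k) A.
Proof.
move=> sA; elim: k => [|k IHk]; first by rewrite (_ : fmx _ _ = fmx (fun=> 1) A) ?fmx_cst.
rewrite exprS {}IHk -[A in A * _](fmx_id sA) [LHS](fmxM id)//.
by apply: eq_fmx => i; rewrite exprS.
Qed.

(** This form makes [fmx g A] visibly linear in g and continuous for pointwise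
    convergence of g on the spectrum. *)
Lemma fmx_rank1 g A : fmx g A =
  \sum_k g (spec A k) *: (col k (spectral_dec A).1 *m (col k (spectral_dec A).1)^T).
Proof.
apply/matrixP => i j; rewrite /fmx -lock mxE summxE; apply: eq_bigr => k _.
by rewrite mul_mx_diag !mxE big_ord1 !mxE -/(spec A k); ring.
Qed.

Lemma expmE A : A^T = A -> expm A = fmx expR A.
Proof.
move=> sA; apply: cvg_lim => //.
rewrite (_ : series _ = fun m => fmx (fun t => series (exp_coeff t) m) A).
  under eq_fun => m do rewrite fmx_rank1.
  rewrite fmx_rank1; apply: cvg_big => [|k _].
    exact: add_continuous.
  apply: cvgZr_tmp; exact: is_cvg_series_exp_coeff.
apply/funext => m; rewrite /series/=; elim: m => [|m IHm].
  transitivity (0%:M : 'M[R]_n); first by rewrite big_geq// raddf0.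
  by rewrite -(fmx_cst 0 sA); apply: eq_fmx => i; rewrite big_geq.
rewrite big_nat_recr//= IHm fmx_pow//.
rewrite !fmx_rank1 scaler_sumr -big_split/=; apply: eq_bigr => k _.
by rewrite scalerA -scalerDl big_nat_recr//= /exp_coeff/= [_ / _]mulrC.
Qed.

Lemma logmE A : spd A -> logm A = fmx (@ln R) A.
Proof.
move=> pA; have sA := spd_sym pA; apply: xget_unique => [|L [sL eL]].
  split; first exact: tr_fmx.
  rewrite expmE ?tr_fmx// fmx_comp// -[RHS](fmx_id sA); apply: eq_fmx => i /=.
  by rewrite lnK// posrE spd_spec.
rewrite -eL expmE// fmx_comp// -[LHS](fmx_id sL); apply: eq_fmx => i /=.
by rewrite expRK.
Qed.

Lemma sqrtmE A : spd A -> sqrtm A = fmx (@Num.sqrt R) A.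
Proof.
move=> pA; have sA := spd_sym pA; apply: xget_unique => [|B [pB BB]].
  split; first by apply: spd_fmx => // i; rewrite sqrtr_gt0 spd_spec.
  rewrite fmxM// -[RHS](fmx_id sA); apply: eq_fmx => i /=.
  by rewrite -expr2 sqr_sqrtr// ltW// spd_spec.
have sB := spd_sym pB; rewrite -BB -{2 3}(fmx_id sB) fmxM// fmx_comp//.
rewrite -[LHS](fmx_id sB); apply: eq_fmx => i /=.
by rewrite -expr2 sqrtr_sqr gtr0_norm// spd_spec.
Qed.

Lemma spd_sqrtm A : spd A -> spd (sqrtm A).
Proof.
move=> pA; rewrite sqrtmE//; apply: spd_fmx; first exact: spd_sym.
by move=> i; rewrite sqrtr_gt0 spd_spec.
Qed.

Lemma mul_sqrtm A : spd A -> sqrtm A *m sqrtm A = A.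
Proof.
move=> pA; have sA := spd_sym pA; rewrite sqrtmE// fmxM// -[RHS](fmx_id sA).
by apply: eq_fmx => i; rewrite -expr2 sqr_sqrtr// ltW// spd_spec.
Qed.

Lemma isqrtmE A : spd A -> isqrtm A = fmx (fun t => (Num.sqrt t)^-1) A.
Proof.
move=> pA; have sA := spd_sym pA.
rewrite /isqrtm (spd_inv (spd_sqrtm pA)).2 sqrtmE// fmx_comp//.
Qed.

Lemma tr_isqrtm A : spd A -> (isqrtm A)^T = isqrtm A.
Proof. by move=> pA; rewrite isqrtmE// tr_fmx. Qed.

Lemma mul_isqrtm A : spd A -> isqrtm A *m isqrtm A = invmx A.
Proof.
move=> pA; have sA := spd_sym pA; rewrite isqrtmE// fmxM// (spd_inv pA).2.
apply: eq_fmx => i; rewrite -invfM -expr2 sqr_sqrtr// ltW//.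
exact: spd_spec.
Qed.

End MatrixFunctions.

(** * Scalar estimates for the logarithm *)

Section ScalarEstimates.
Context {R : realType}.
Implicit Types x y z c : R.

Lemma ln_sub_le y z : 0 < y -> 0 < z -> ln z - ln y <= (z - y) / y.
Proof.
move=> y0 z0; rewrite -ln_div ?posrE//.
have -> : (z - y) / y = z / y - 1 by field; rewrite gt_eqF.
have := @le_ln1Dx R (z / y - 1); rewrite addrCA subrr addr0; apply.
by rewrite ltrBrDl subrr divr_gt0.
Qed.

Section Pinched.
Variables (c y z : R).
Hypotheses (c0 : 0 < c) (hy : c^-1 <= y <= c) (hz : c^-1 <= z <= c).

Let y0 : 0 < y. Proof. by case/andP: hy => h _; apply: lt_le_trans h; rewrite invr_gt0. Qed.
Let z0 : 0 < z. Proof. by case/andP: hz => h _; apply: lt_le_trans h; rewrite invr_gt0. Qed.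
Let yV : y^-1 <= c. Proof. by case/andP: hy => h _; rewrite -[c]invrK lef_pV2 ?posrE ?invr_gt0. Qed.
Let zV : z^-1 <= c. Proof. by case/andP: hz => h _; rewrite -[c]invrK lef_pV2 ?posrE ?invr_gt0. Qed.

Lemma ln_lipschitz : `|ln z - ln y| <= c * `|z - y|.
Proof.
have h a b : 0 < a -> 0 < b -> a^-1 <= c -> ln b - ln a <= c * `|b - a|.
  move=> a0 b0 aV; apply: le_trans (ln_sub_le a0 b0) _.
  apply: le_trans (ler_norm _) _; rewrite normrM mulrC ler_wpM2r//.
  by rewrite gtr0_norm ?invr_gt0.
by rewrite ler_norml lerNl opprB h// distrC h.
Qed.

Lemma ln_abs_le : `|ln y| <= c.
Proof.
have lt a : 0 < a -> a <= c -> ln a <= c.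
  by move=> a0 ac; apply: le_trans ac; apply: ltW; apply: ln_sublinear.
case/andP: hy => _ yc.
by rewrite ler_norml lerNl -lnV ?posrE// !lt// invr_gt0.
Qed.

Lemma inv_sub_sqr : (z - y) / y - (z - y) / z <= c ^+ 2 * (z - y) ^+ 2.
Proof.
have -> : (z - y) / y - (z - y) / z = (y^-1 * z^-1) * (z - y) ^+ 2.
  by field; rewrite !gt_eqF.
by rewrite ler_wpM2r ?sqr_ge0// expr2 ler_pM// invr_ge0 ltW.
Qed.

Lemma ln_taylor : `|ln z - ln y - (z - y) / y| <= c ^+ 2 * (z - y) ^+ 2.
Proof.
have h1 := ln_sub_le y0 z0; have h2 := ln_sub_le z0 y0; have h3 := inv_sub_sqr.
have h4 : (y - z) / z = - ((z - y) / z) by rewrite -mulNr opprB.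
have h5 : 0 <= c ^+ 2 * (z - y) ^+ 2 by rewrite mulr_ge0 ?sqr_ge0.
by rewrite ler_norml; apply/andP; split; lra.
Qed.

(** With X = ln z - ln y, the left-hand side is X^2 + 2 ln y (X - (z - y) / y);
    the Lipschitz bound on ln controls the first term, its Taylor bound the
    second. *)
Lemma sqr_ln_taylor :
  `|ln z ^+ 2 - ln y ^+ 2 - (2 * ln y / y) * (z - y)|
    <= (c ^+ 2 + 2 * c ^+ 3) * (z - y) ^+ 2.
Proof.
have -> : ln z ^+ 2 - ln y ^+ 2 - (2 * ln y / y) * (z - y) =
    (ln z - ln y) ^+ 2 + 2 * ln y * (ln z - ln y - (z - y) / y).
  by field; rewrite gt_eqF.
apply: le_trans (ler_normD _ _) _; rewrite [leRHS]mulrDl; apply: lerD.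
  rewrite normrX -(real_normK (num_real (z - y))) -exprMn.
  by rewrite lerXn2r ?ln_lipschitz ?nnegrE ?mulr_ge0 ?(ltW c0).
rewrite normrM normrM (ger0_norm (ler0n _ 2)).
rewrite (_ : 2 * c ^+ 3 * _ = 2 * c * (c ^+ 2 * (z - y) ^+ 2)); last by ring.
by rewrite ler_pM ?mulr_ge0 ?ln_taylor ?ler_wpM2l ?ln_abs_le.
Qed.

Lemma inv_lipschitz : `|z^-1 - y^-1| <= c ^+ 2 * `|z - y|.
Proof.
have -> : z^-1 - y^-1 = z^-1 * y^-1 * - (z - y) by field; rewrite !gt_eqF.
rewrite normrM normrN ler_wpM2r// gtr0_norm ?mulr_gt0 ?invr_gt0//.
by rewrite expr2 ler_pM// invr_ge0 ltW.
Qed.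

Lemma isqrt_lipschitz :
  `|(Num.sqrt z)^-1 - (Num.sqrt y)^-1| <= Num.sqrt c ^+ 3 * `|z - y|.
Proof.
have sz : 0 < Num.sqrt z by rewrite sqrtr_gt0.
have sy : 0 < Num.sqrt y by rewrite sqrtr_gt0.
have E a : 0 < a -> a^-1 <= c -> (Num.sqrt a)^-1 <= Num.sqrt c.
  by move=> a0 aV; rewrite -sqrtrV ?ler_sqrt// ltW.
have -> : (Num.sqrt z)^-1 - (Num.sqrt y)^-1 =
   - ((z - y) * ((Num.sqrt z)^-1 * (Num.sqrt y)^-1 * (Num.sqrt z + Num.sqrt y)^-1)).
  rewrite (_ : z - y = (Num.sqrt z - Num.sqrt y) * (Num.sqrt z + Num.sqrt y)).
    by field; rewrite !gt_eqF// addr_gt0.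
  by rewrite -subr_sqr !sqr_sqrtr ?(ltW z0) ?(ltW y0).
rewrite normrN normrM mulrC ler_wpM2r// gtr0_norm ?mulr_gt0 ?invr_gt0 ?addr_gt0//.
have h : (Num.sqrt z + Num.sqrt y)^-1 <= (Num.sqrt z)^-1.
  by rewrite lef_pV2 ?posrE ?addr_gt0// lerDl ltW.
rewrite !exprSr expr0 mul1r.
rewrite ler_pM ?mulr_ge0 ?invr_ge0 ?addr_ge0 ?(ltW sz) ?(ltW sy)//.
  by rewrite ler_pM ?invr_ge0 ?(ltW sz) ?(ltW sy) ?E.
by apply: le_trans h _; apply: E.
Qed.

End Pinched.
End ScalarEstimates.

(** * Matrices with spectrum in a fixed interval *)

Section Pinched.
Context {R : realType} {n : nat}.
Implicit Types (A B Y Z G w : 'M[R]_n) (c K : R).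

(** The symmetric matrices with spectrum in the interval from 1/c to c: a single
    constant c > 0 controls the matrix, its inverse and its logarithm. *)
Definition pinched c A := A^T = A /\ forall i, c^-1 <= spec A i <= c.

Lemma pinched_spd c A : 0 < c -> pinched c A -> spd A.
Proof.
move=> c0 [sA bA]; apply: spec_spd => // i; have /andP[h _] := bA i.
by apply: lt_le_trans h; rewrite invr_gt0.
Qed.

Lemma fnorm_fmx g A : A^T = A -> fnorm (fmx g A) ^+ 2 = \sum_i g (spec A i) ^+ 2.
Proof. by move=> sA; rewrite sqr_fnorm /fdot tr_fmx fmxM// trace_fmx. Qed.

Lemma fnorm_fmx_ge g A i : A^T = A -> `|g (spec A i)| <= fnorm (fmx g A).
Proof.
move=> sA; rewrite -(@ler_pXn2r _ 2) ?nnegrE ?fnorm_ge0// fnorm_fmx//.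
rewrite real_normK ?num_real// (bigD1 i)//= lerDl sumr_ge0// => j _.
exact: sqr_ge0.
Qed.

Lemma spec_abs_le A i : A^T = A -> `|spec A i| <= fnorm A.
Proof. by move=> sA; have := fnorm_fmx_ge id i sA; rewrite fmx_id. Qed.

Lemma fnorm_fmx_le g A K : A^T = A -> 0 <= K ->
  (forall i, `|g (spec A i)| <= K) -> fnorm (fmx g A) <= n%:R * K.
Proof.
move=> sA K0 gK; rewrite -(@ler_pXn2r _ 2) ?nnegrE ?fnorm_ge0 ?mulr_ge0//.
rewrite fnorm_fmx//; apply: (@le_trans _ _ (\sum_(i < n) K ^+ 2)).
  by apply: ler_sum => i _; rewrite -real_normK ?num_real// lerXn2r ?nnegrE.
rewrite sumr_const card_ord -[K ^+ 2 *+ n]mulr_natl exprMn ler_wpM2r ?sqr_ge0//.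
by rewrite -natrX ler_nat; case: (n) => // m; rewrite leq_pmulr.
Qed.

Lemma pinched_le c c' A :
  0 < c -> c <= c' -> pinched c A -> pinched c' A.
Proof.
move=> c0 cc' [sA bA]; split=> // i; have /andP[h1 h2] := bA i.
have c'0 : 0 < c' by exact: lt_le_trans cc'.
apply/andP; split; last exact: le_trans cc'.
by apply: le_trans h1; rewrite lef_pV2.
Qed.

(** Bounds on |A| and |A^-1| are how uniform bounds on spectra are obtained
    below, because the Frobenius norm is submultiplicative. *)
Lemma pinched_of_fnorm c A : 0 < c -> spd A ->
  fnorm A <= c -> fnorm (invmx A) <= c -> pinched c A.
Proof.
move=> c0 pA Ac AVc; have sA := spd_sym pA; split=> // i.
have s0 := spd_spec pA i; apply/andP; split; last first.
  apply: le_trans Ac; rewrite -{2}(fmx_id sA); apply: le_trans (fnorm_fmx_ge id i sA).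
  exact: ler_norm.
rewrite -[leRHS]invrK lef_pV2 ?posrE ?invr_gt0//; apply: le_trans AVc.
rewrite (spd_inv pA).2; apply: le_trans (fnorm_fmx_ge GRing.inv i sA).
exact: ler_norm.
Qed.

Lemma pinched_fnorm c A : 0 < c -> pinched c A -> fnorm A <= n%:R * c.
Proof.
move=> c0 pA; have [sA bA] := pA; rewrite -(fmx_id sA); apply: fnorm_fmx_le; rewrite ?ltW// => i.
have /andP[_ h] := bA i.
by rewrite gtr0_norm//; apply: spd_spec; apply: pinched_spd pA.
Qed.

Lemma pinched_fnorm_inv c A : 0 < c -> pinched c A -> fnorm (invmx A) <= n%:R * c.
Proof.
move=> c0 pA; have [sA bA] := pA; have sp := pinched_spd c0 pA.
rewrite (spd_inv sp).2; apply: fnorm_fmx_le; rewrite ?ltW// => i.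
have /andP[h _] := bA i; have s0 := spd_spec sp i.
by rewrite gtr0_norm ?invr_gt0// -[leRHS]invrK lef_pV2 ?posrE ?invr_gt0.
Qed.

Lemma pinched_fnorm_log c A : 0 < c -> pinched c A -> fnorm (logm A) <= n%:R * c.
Proof.
move=> c0 pA; have [sA bA] := pA; have sp := pinched_spd c0 pA.
rewrite logmE//; apply: fnorm_fmx_le; rewrite ?ltW// => i.
exact: ln_abs_le (bA i).
Qed.

Lemma fmxZ a g A : fmx (fun t => a * g t) A = a *: fmx g A.
Proof. by rewrite !fmx_rank1 scaler_sumr; apply: eq_bigr => k _; rewrite scalerA. Qed.

Lemma abs_trace_mul A B : `|\tr (A *m B)| <= fnorm A * fnorm B.
Proof. by rewrite -(fnorm_tr A); have := cauchy_schwarz A^T B; rewrite /fdot trmxK. Qed.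

(** Twice the squared Fisher-Rao distance from A to the identity. *)
Definition sqlog A := fnorm (logm A) ^+ 2.

Lemma sqlogE A : spd A -> sqlog A = \tr (fmx (fun t => ln t ^+ 2) A).
Proof.
move=> pA; rewrite /sqlog logmE// sqr_fnorm /fdot tr_fmx fmxM//; exact: spd_sym.
Qed.

(** Half of the Euclidean gradient of [sqlog]. *)
Definition logdiv A := logm A *m invmx A.

Lemma logdivE A : spd A -> logdiv A = fmx (fun t => ln t / t) A.
Proof. by move=> pA; rewrite /logdiv logmE// (spd_inv pA).2 fmxM//; exact: spd_sym. Qed.

Section TwoPoints.
Variables (c : R) (Y Z : 'M[R]_n).
Hypotheses (c0 : 0 < c) (hY : pinched c Y) (hZ : pinched c Z).

Let sY : Y^T = Y. Proof. by case: hY. Qed.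
Let sZ : Z^T = Z. Proof. by case: hZ. Qed.
Let pY : spd Y. Proof. exact: pinched_spd hY. Qed.
Let pZ : spd Z. Proof. exact: pinched_spd hZ. Qed.

Lemma logm_lipschitz : fnorm (logm Z - logm Y) <= c * fnorm (Z - Y).
Proof.
rewrite !logmE//; apply: fmx_lipschitz => //; first exact: ltW.
by move=> i j; apply: ln_lipschitz => //; [case: hY|case: hZ].
Qed.

Lemma invmx_lipschitz : fnorm (invmx Z - invmx Y) <= c ^+ 2 * fnorm (Z - Y).
Proof.
rewrite !(spd_inv _).2//; apply: fmx_lipschitz => //; first exact: sqr_ge0.
by move=> i j; apply: inv_lipschitz => //; [case: hY|case: hZ].
Qed.

Lemma isqrtm_lipschitz : fnorm (isqrtm Z - isqrtm Y) <= Num.sqrt c ^+ 3 * fnorm (Z - Y).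
Proof.
rewrite !isqrtmE//; apply: fmx_lipschitz => //.
by move=> i j; apply: isqrt_lipschitz => //; [case: hY|case: hZ].
Qed.

Lemma klein_trace_abs g g' (k : R) :
  (forall i j, `|g (spec Z j) - g (spec Y i) - g' (spec Y i) * (spec Z j - spec Y i)|
                               <= k * (spec Z j - spec Y i) ^+ 2) ->
  `|\tr (fmx g Z) - \tr (fmx g Y) - fdot (fmx g' Y) (Z - Y)| <= k * fnorm (Z - Y) ^+ 2.
Proof.
move=> h; have hu i j : g (spec Z j) <= g (spec Y i) +
    g' (spec Y i) * (spec Z j - spec Y i) + k * (spec Z j - spec Y i) ^+ 2.
  by have := h i j; rewrite ler_norml => /andP[_]; lra.
have hl i j : -1 * g (spec Z j) <= -1 * g (spec Y i) +
    (-1 * g' (spec Y i)) * (spec Z j - spec Y i) + k * (spec Z j - spec Y i) ^+ 2.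
  by have := h i j; rewrite ler_norml => /andP[+ _]; lra.
have Ku := klein_trace sY sZ hu.
have := @klein_trace _ (fun t => -1 * g t) (fun t => -1 * g' t) k _ _ _ sY sZ hl.
rewrite !fmxZ !mxtraceZ fdotZl => Kl.
by rewrite ler_norml; apply/andP; split; lra.
Qed.

Lemma sqlog_taylor : `|sqlog Z - sqlog Y - 2 * fdot (logdiv Y) (Z - Y)|
  <= (c ^+ 2 + 2 * c ^+ 3) * fnorm (Z - Y) ^+ 2.
Proof.
rewrite !sqlogE// logdivE// -fdotZl -fmxZ.
rewrite (_ : fmx (fun t => 2 * _) Y = fmx (fun t => 2 * ln t / t) Y); last first.
  by apply: eq_fmx => i; rewrite mulrA.
apply: klein_trace_abs => i j; apply: sqr_ln_taylor => //; [by case: hY|by case: hZ].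
Qed.

Lemma tr_logm_taylor : `|\tr (logm Z) - \tr (logm Y) - fdot (invmx Y) (Z - Y)|
  <= c ^+ 2 * fnorm (Z - Y) ^+ 2.
Proof.
rewrite !logmE// (spd_inv pY).2.
apply: klein_trace_abs => i j; rewrite [_^-1 * _]mulrC.
by apply: ln_taylor => //; [case: hY|case: hZ].
Qed.

(** In terms of eigenvalues, this is an average of
    (z - y) (ln z - ln y) / y >= 0.  The factor Y^-1 does not break the symmetry,
    since it is diagonal in the eigenbasis of Y. *)
Lemma logm_monotone :
  0 <= \tr (invmx Y *m (Z - Y) *m (logm Z - logm Y)).
Proof.
have [p [p0 pE]] := mixed_trace sY sZ.
have h1 a : \tr (fmx a Y) = \sum_i \sum_j p i j * (a (spec Y i) * 1).
  by have := pE a (fun=> 1); rewrite (fmx_cst _ sZ) mulmx1.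
have h2 b : \tr (fmx b Z) = \sum_i \sum_j p i j * (1 * b (spec Z j)).
  by have := pE (fun=> 1) b; rewrite (fmx_cst _ sY) mul1mx.
have -> : \tr (invmx Y *m (Z - Y) *m (logm Z - logm Y)) =
    \tr (fmx GRing.inv Y *m fmx (fun t => t * ln t) Z) + \tr (fmx (@ln R) Y)
    - \tr (fmx (fun t => ln t / t) Y *m fmx id Z) - \tr (fmx (@ln R) Z).
  rewrite -(fmxM id)// -(fmxM (@ln R) GRing.inv)// -(spd_inv pY).2 !fmx_id//.
  rewrite (mulmxBr (invmx Y)) mulVmx ?spd_unit// mulmxBl mul1mx mulmxBr !raddfB/=.
  rewrite !logmE// -!(mulmxA (fmx _ Y)) (mxtrace_mulC (fmx _ Y)) !mulmxA; ring.
rewrite !h1 !h2 !pE -big_split -!sumrB; apply: sumr_ge0 => i _.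
rewrite -big_split -!sumrB; apply: sumr_ge0 => j _ /=.
have y0 := spd_spec pY i; have z0 := spd_spec pZ j.
rewrite [leRHS](_ : _ = p i j * ((spec Y i)^-1 *
    ((spec Z j - spec Y i) * (ln (spec Z j) - ln (spec Y i))))); last first.
  by field; rewrite gt_eqF.
apply: mulr_ge0 => //; apply: mulr_ge0; first by rewrite invr_ge0 ltW.
have [zy|yz] := leP (spec Z j) (spec Y i).
  by rewrite mulr_le0 ?subr_le0// ler_ln.
by rewrite mulr_ge0 ?subr_ge0 ?ler_ln// ltW.
Qed.

End TwoPoints.
End Pinched.

(** * Law of cosines *)

Section CosineLaw.
Context {R : realType}.

Lemma expR_taylor (u : R) : `|u| <= 2^-1 -> `|expR u - 1 - u| <= 2 * u ^+ 2.
Proof.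
rewrite ler_norml => /andP[ul uu]; have h1 := expR_ge1Dx u.
have h2 := expR_ge1Dx (- u); have e0 := expR_gt0 u.
have eN : expR u * expR (- u) = 1 by rewrite expRN mulfV ?gt_eqF.
have h3 : expR u * (1 - u) <= 1 by rewrite -[leRHS]eN ler_wpM2l // ltW.
have h4 : expR u <= 1 + u + 2 * u ^+ 2.
  rewrite -(@ler_pM2r _ (1 - u)); last by lra.
  apply: le_trans h3 _; rewrite -subr_ge0.
  have -> : (1 + u + 2 * u ^+ 2) * (1 - u) - 1 = u ^+ 2 * (1 - 2 * u) by ring.
  by rewrite mulr_ge0 ?sqr_ge0//; lra.
rewrite ger0_norm; lra.
Qed.

Lemma second_order_arith (x1 x2 x3 x4 x5 x6 x7 x8 : R) : 0 <= x3 -> x6 <= x5 ->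
  - x6 <= x2 - x1 - 2 * (x7 + x8) -> - x4 <= x8 ->
  x1 + 2 * x7 - (x3 + 2 * x4 + x5) <= x2.
Proof. by move=> h1 h2 h3 h4; lra. Qed.

(** A C^1 function phi with derivative 2 F, F nondecreasing, is convex and lies
    above its tangent at 0.  Here both assumptions are discretized with errors
    O(d^2), whose sum over 1 / d steps is O(d). *)
Lemma convex_from_local (phi F : R -> R) (C d0 : R) : 0 < d0 ->
  (forall s d, 0 <= s -> 0 < d -> d <= d0 -> s + d <= 1 ->
     F s - C * d ^+ 2 <= F (s + d) /\
     phi s + 2 * d * F s - C * d ^+ 2 <= phi (s + d)) ->
  phi 0 + 2 * F 0 <= phi 1.
Proof.
move=> d00 step.
have C0 : 0 <= `|C| by [].
have CC : C <= `|C| by exact: ler_norm.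
have main N : d0^-1 <= N.+1%:R -> phi 0 + 2 * F 0 - 3 * `|C| / N.+1%:R <= phi 1.
  move=> hN; set d : R := N.+1%:R^-1.
  have N0 : 0 < N.+1%:R :> R by rewrite ltr0n.
  have dp : 0 < d by rewrite invr_gt0.
  have dN : d * N.+1%:R = 1 by rewrite mulVf ?gt_eqF.
  have dd : d <= d0 by rewrite -[d0]invrK lef_pV2 ?posrE ?invr_gt0.
  have dsum (k : nat) : (k <= N.+1)%N -> k%:R * d <= 1.
    by move=> kN; rewrite -[leRHS]dN mulrC ler_pM2l// ler_nat.
  have ind (k : nat) : (k <= N.+1)%N ->
      F 0 - `|C| * d * (k%:R * d) <= F (k%:R * d) /\
      phi 0 + 2 * (k%:R * d) * (F 0 - `|C| * d) - `|C| * d * (k%:R * d) <= phi (k%:R * d).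
    elim: k => [_|k IHk kN]; first by rewrite !mul0r !mulr0 mul0r !subr0 addr0.
    have [h1 h2] := IHk (ltnW kN).
    have kd := dsum _ kN; rewrite -natr1 mulrDl mul1r in kd *.
    have kd0 : 0 <= k%:R * d by rewrite mulr_ge0// ltW.
    have [] := step (k%:R * d) d kd0 dp dd kd.
    move: (k%:R * d) h1 h2 kd kd0 => s h1 h2 kd kd0 h3 h4.
    have hC : C * d ^+ 2 <= `|C| * d * d by rewrite expr2 mulrA -!mulrA ler_wpM2r// mulr_ge0// ltW.
    have hs : `|C| * d * s <= `|C| * d by rewrite ler_piMr ?mulr_ge0 ?(ltW dp)//; lra.
    split; first by rewrite mulrDr; lra.
    have h5 : d * (F 0 - `|C| * d) <= d * F s by rewrite ler_wpM2l ?(ltW dp)//; lra.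
    rewrite !mulrDr !mulrDl; lra.
  have [_] := ind N.+1 (leqnn _); rewrite [_ * d]mulrC dN !mulr1.
  rewrite -/d; lra.
apply/ler_addgt0Pr => e e0.
(* The number of steps: at least 1/d0, and large enough to absorb 3 |C| / e. *)
pose m := Num.truncn (Num.max d0^-1 (3 * `|C| / e)).
have hm : Num.max d0^-1 (3 * `|C| / e) <= m.+1%:R.
  by apply/ltW; rewrite /m truncnS_gt.
move: hm; rewrite ge_max => /andP[hm1 hm2].
have := main m hm1; rewrite lerBlDr => /le_trans; apply; rewrite lerD2l.
by rewrite ler_pdivrMr ?ltr0n// [leRHS]mulrC -ler_pdivrMr.
Qed.

Variables (n : nat) (G w : 'M[R]_n).
Hypotheses (Gu : G \in unitmx) (sw : w^T = w).

Let H := invmx G^T.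
Let W := H *m w *m G^T.
Let geod t := G *m fmx (fun x => expR (t * x)) w *m G^T.
Let E d := fmx (fun x => expR (d * x) - 1) w.
Let V d := H *m E d *m G^T.

Let GH : G^T *m H = 1%:M. Proof. by rewrite mulmxV// unitmx_tr. Qed.

Let geodD s d : geod (s + d) - geod s = geod s *m V d.
Proof.
rewrite /geod /V /E !mulmxA -(mulmxA _ G^T) GH mulmx1.
rewrite -(mulmxA G _ (fmx (fun x => expR (d * x) - 1) w)) fmxM// -mulmxBl -mulmxBr.
congr (_ *m _ *m _).
rewrite -[X in _ - X]scale1r -scaleNr -fmxZ !fmx_rank1 -big_split/=.
apply: eq_bigr => i _; rewrite -scalerDl; congr (_ *: _).
by rewrite mulrDl expRD; ring.
Qed.

Let geod_spd t : spd (geod t).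
Proof. by apply: spd_congr => //; apply: spd_fmx => // i; exact: expR_gt0. Qed.

Let geod_inv t : invmx (geod t) = H *m fmx (fun x => expR (- t * x)) w *m invmx G.
Proof.
have e : geod t *m (H *m fmx (fun x => expR (- t * x)) w *m invmx G) = 1%:M.
  rewrite /geod !mulmxA -(mulmxA _ G^T) GH mulmx1 -(mulmxA G) fmxM//.
  rewrite (_ : fmx _ w = 1%:M) ?mulmx1 ?mulmxV// -(fmx_cst 1 sw).
  by apply: eq_fmx => i; rewrite -expRD mulNr subrr expR0.
by have [u _] := mulmx1_unit e; rewrite -[RHS](mulKmx u) e mulmx1.
Qed.

Let geod_pinched : exists2 c, 0 < c & forall t, 0 <= t <= 1 -> pinched c (geod t).
Proof.
(* For |t| <= 1 the norms of G e^(t w) G^T and of its inverse are bounded. *)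
pose b := n%:R * expR (fnorm w).
have bE t : -1 <= t <= 1 -> fnorm (fmx (fun x => expR (t * x)) w) <= b.
  move=> t1; apply: fnorm_fmx_le => // i.
  rewrite gtr0_norm ?expR_gt0// ler_expR; apply: le_trans (ler_norm _) _.
  rewrite normrM -[leRHS]mul1r ler_pM//; first by rewrite ler_norml.
  exact: spec_abs_le.
exists (fnorm G * b * fnorm G^T + fnorm H * b * fnorm (invmx G) + 1).
  by rewrite ltr_wpDl// addr_ge0// !mulr_ge0 ?fnorm_ge0// expR_ge0.
move=> t t01; have b0 : 0 <= b by rewrite mulr_ge0// expR_ge0.
have h (A B X : 'M[R]_n) : fnorm X <= b -> fnorm (A *m X *m B) <= fnorm A * b * fnorm B.
  move=> Xb; apply: le_trans (fnormM _ _) _; rewrite ler_wpM2r ?fnorm_ge0//.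
  by apply: le_trans (fnormM _ _) _; rewrite ler_wpM2l ?fnorm_ge0.
have h1 := h G G^T _ (bE t ltac:(lra)).
have h2 := h H (invmx G) _ (bE (- t) ltac:(lra)).
have p1 : 0 <= fnorm G * b * fnorm G^T by rewrite !mulr_ge0 ?fnorm_ge0.
have p2 : 0 <= fnorm H * b * fnorm (invmx G) by rewrite !mulr_ge0 ?fnorm_ge0.
apply: pinched_of_fnorm => //; first lra.
  by apply: le_trans h1 _; lra.
by rewrite geod_inv; apply: le_trans h2 _; lra.
Qed.

Let F s := \tr (logm (geod s) *m W).

(** With V d = geod(s)^-1 geod(s + d) - 1 = d W + O(d^2), the monotonicity of
    the logarithm is exactly tr (V d (log geod(s + d) - log geod(s))) >= 0, and
    replacing V d by d W costs O(d^2) times a difference of logarithms that is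
    itself O(d). *)
Lemma sqlog_geodesic : sqlog (geod 0) + 2 * F 0 <= sqlog (geod 1).
Proof.
have [c c0 pc] := geod_pinched.
pose b := fnorm w; pose h := fnorm H * fnorm G^T; pose g := n%:R * c.
pose v := 2 * h * n%:R * b; pose r := 2 * h * n%:R * b ^+ 2.
have [b0 h0 g0] : [/\ 0 <= b, 0 <= h & 0 <= g].
  by rewrite /b /h /g fnorm_ge0 !mulr_ge0 ?fnorm_ge0 ?(ltW c0).
have v0 : 0 <= v by rewrite /v !mulr_ge0 ?fnorm_ge0.
have r0 : 0 <= r by rewrite /r !mulr_ge0 ?sqr_ge0 ?fnorm_ge0.
pose k := c ^+ 2 + 2 * c ^+ 3; have k0 : 0 <= k by rewrite addr_ge0 ?mulr_ge0 ?exprn_ge0 ?ltW.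
have spw d i : 0 <= d -> `|d * spec w i| <= d * b.
  by move=> d0; rewrite normrM ger0_norm// ler_wpM2l// spec_abs_le.
have sand X x : fnorm X <= x -> fnorm (H *m X *m G^T) <= h * x.
  move=> Xx; apply: le_trans (fnormM _ _) _.
  rewrite /h mulrAC ler_wpM2r ?fnorm_ge0//.
  by apply: le_trans (fnormM _ _) _; rewrite ler_wpM2l ?fnorm_ge0.
apply: (@convex_from_local (sqlog \o geod) F
  (r * c * g * v + 2 * g * r + k * (g * v) ^+ 2) (2 * b + 1)^-1).
  by rewrite invr_gt0; lra.
move=> s d s0 d0 dd sd1.
have db : d * b <= 2^-1.
  have : d * (2 * b + 1) <= 1 by rewrite -ler_pdivlMr ?mul1r//; lra.
  rewrite mulrDr mulrCA; lra.
have d0' := ltW d0.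
have pY := pc s ltac:(lra); have pZ := pc (s + d) ltac:(lra).
have tay i : `|expR (d * spec w i) - 1 - d * spec w i| <= 2 * (d * b) ^+ 2.
  apply: le_trans (expR_taylor _) _; first by apply: le_trans (spw _ _ d0') _.
  rewrite ler_wpM2l// -real_normK ?num_real// lerXn2r ?nnegrE ?mulr_ge0 ?fnorm_ge0 ?(ltW c0)//.
  exact: spw.
have Ed : fnorm (E d) <= n%:R * (2 * (d * b)).
  apply: fnorm_fmx_le => //; first by rewrite !mulr_ge0 ?fnorm_ge0 ?(ltW c0).
  move=> i; have := tay i; have := spw d i d0'.
  rewrite !ler_norml => /andP[x1 x2] /andP[x3 x4].
  have : (d * b) ^+ 2 <= 2^-1 * (d * b) by rewrite expr2 ler_wpM2r// mulr_ge0 ?fnorm_ge0 ?(ltW c0).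
  move=> x5; apply/andP; split; lra.
have Edw : fnorm (E d - d *: w) <= n%:R * (2 * (d * b) ^+ 2).
  have -> : E d - d *: w = fmx (fun x => expR (d * x) - 1 - d * x) w.
    rewrite /E -[in X in _ - X](fmx_id sw) -scaleNr -fmxZ !fmx_rank1 -big_split/=.
    by apply: eq_bigr => i _; rewrite -scalerDl mulNr.
  by apply: fnorm_fmx_le => //; rewrite mulr_ge0 ?sqr_ge0.
have Vd : fnorm (V d) <= d * v.
  apply: le_trans (sand _ _ Ed) _.
  by rewrite le_eqVlt; apply/orP; left; apply/eqP; rewrite /v; ring.
have VdW : fnorm (V d - d *: W) <= d ^+ 2 * r.
  rewrite /V /W scalemxAl scalemxAr -mulmxBl -mulmxBr.
  apply: le_trans (sand _ _ Edw) _.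
  by rewrite le_eqVlt; apply/orP; left; apply/eqP; rewrite /r; ring.
have Yg : fnorm (geod s) <= g by exact: pinched_fnorm pY.
have Dl : fnorm (geod (s + d) - geod s) <= g * (d * v).
  rewrite geodD; apply: le_trans (fnormM _ _) _.
  by rewrite ler_pM ?fnorm_ge0.
have a1 : 0 <= r * c * g * v * d ^+ 2 by rewrite !mulr_ge0 ?fnorm_ge0 ?sqr_ge0 ?(ltW c0).
have a2 : 0 <= 2 * g * r * d ^+ 2 by rewrite !mulr_ge0 ?fnorm_ge0 ?sqr_ge0 ?(ltW c0).
have a3 : 0 <= k * (g * v) ^+ 2 * d ^+ 2.
  by apply: mulr_ge0; rewrite ?sqr_ge0//; apply: mulr_ge0; rewrite ?sqr_ge0.
have -> : (r * c * g * v + 2 * g * r + k * (g * v) ^+ 2) * d ^+ 2 =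
    r * c * g * v * d ^+ 2 + 2 * g * r * d ^+ 2 + k * (g * v) ^+ 2 * d ^+ 2.
  by rewrite mulrDl mulrDl.
split.
  have mono := logm_monotone c0 pY pZ.
  rewrite geodD mulmxA mulVmx ?spd_unit// mul1mx in mono.
  have err : `|\tr ((V d - d *: W) *m (logm (geod (s + d)) - logm (geod s)))| <=
      d ^+ 2 * r * (c * (g * (d * v))).
    apply: le_trans (abs_trace_mul _ _) _; rewrite ler_pM ?fnorm_ge0//.
    by apply: le_trans (logm_lipschitz c0 pY pZ) _; rewrite ler_wpM2l// ltW.
  have eq : d * (F (s + d) - F s) = \tr (V d *m (logm (geod (s + d)) - logm (geod s)))
     - \tr ((V d - d *: W) *m (logm (geod (s + d)) - logm (geod s))).
    have gen (A D X : 'M[R]_n) : \tr (A *m X) - \tr ((A - D) *m X) = \tr (D *m X).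
      by rewrite mulmxBl [\tr (_ - _)]raddfB/= opprB addrC subrK.
    rewrite gen -scalemxAl mxtraceZ; congr (_ * _); rewrite mxtrace_mulC mulmxBl.
    by rewrite [RHS]raddfB.
  have : - (r * c * g * v * d ^+ 2) <= F (s + d) - F s.
    clear a1 a2 a3; rewrite -(ler_pM2l d0) eq.
    have -> : d * - (r * c * g * v * d ^+ 2) = - (d ^+ 2 * r * (c * (g * (d * v)))) by ring.
    move: err; rewrite ler_norml => /andP[_].
    by move=> err'; rewrite -[leLHS]add0r lerD// lerN2.
  rewrite lerBrDl; apply: le_trans; rewrite lerD2l lerN2 -addrA lerDl.
  exact: addr_ge0.
have tayl := sqlog_taylor c0 pY pZ.
have fE : fdot (logdiv (geod s)) (geod (s + d) - geod s) =
    d * F s + \tr (logm (geod s) *m (V d - d *: W)).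
  have lt : (logdiv (geod s))^T = logdiv (geod s) by rewrite logdivE// tr_fmx.
  rewrite /fdot lt geodD mulmxA /logdiv mulmxKV ?spd_unit//.
  have gen (A D X : 'M[R]_n) : \tr (X *m A) = \tr (X *m D) + \tr (X *m (A - D)).
    by rewrite mulmxBr [\tr (_ - _)]raddfB/= addrC subrK.
  by rewrite (gen (V d) (d *: W)) -scalemxAr mxtraceZ.
have err : `|\tr (logm (geod s) *m (V d - d *: W))| <= g * (d ^+ 2 * r).
  apply: le_trans (abs_trace_mul _ _) _; rewrite ler_pM ?fnorm_ge0//.
  exact: pinched_fnorm_log pY.
have quad : k * fnorm (geod (s + d) - geod s) ^+ 2 <= k * (g * v) ^+ 2 * d ^+ 2.
  rewrite -mulrA -exprMn ler_wpM2l// lerXn2r ?nnegrE ?fnorm_ge0 ?mulr_ge0 ?fnorm_ge0 ?(ltW c0)//.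
  by rewrite -mulrA [v * d]mulrC.
rewrite fE -/k in tayl; rewrite /=.
have -> : 2 * g * r * d ^+ 2 = 2 * (g * (d ^+ 2 * r)) by ring.
have -> : 2 * d * F s = 2 * (d * F s) by rewrite mulrA.
move: tayl err; rewrite !ler_norml => /andP[t1 _] /andP[t2 _].
exact: second_order_arith a1 quad t1 t2.
Qed.

(** The triangle has the vertices 1, G G^T and G e^w G^T, and the geodesic from
    the second to the third has initial velocity G w G^T.  The nonnegative term
    |w|^2 of the full law of cosines is dropped. *)
Lemma cosine_law :
  sqlog (G *m G^T) + 2 * \tr (logm (G *m G^T) *m (invmx G^T *m w *m G^T))
    <= sqlog (G *m expm w *m G^T).
Proof.
have E0 : G *m G^T = geod 0.
  rewrite /geod (_ : fmx _ w = 1%:M) ?mulmx1// -(fmx_cst 1 sw).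
  by apply: eq_fmx => i; rewrite mul0r expR0.
have E1 : G *m expm w *m G^T = geod 1.
  have -> : expm w = fmx (fun t => expR (1 * t)) w; last by [].
  by rewrite (expmE sw); apply: eq_fmx => i; rewrite mul1r.
rewrite E0 E1; exact: sqlog_geodesic.
Qed.

End CosineLaw.

(** * Whitening and local expansions *)

Section Geometry.
Context {R : realType} {n : nat}.
Implicit Types (S T A v u : 'M[R]_n).

(** The congruence that maps T to the identity.  It is an isometry of the
    Fisher-Rao metric, so distances to T become norms of logarithms. *)
Definition whiten T S := isqrtm T *m S *m isqrtm T.

Lemma whitenD T S v t : whiten T (S + t *: v) = whiten T S + t *: whiten T v.
Proof. by rewrite /whiten mulmxDr mulmxDl -scalemxAr -scalemxAl. Qed.

Lemma isqrtm_unit T : spd T -> isqrtm T \in unitmx.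
Proof. by move=> pT; rewrite unitmx_inv spd_unit// ; apply: spd_sqrtm. Qed.

Lemma mul_sqrtm_isqrtm T : spd T -> sqrtm T *m isqrtm T = 1%:M.
Proof. by move=> pT; rewrite mulmxV// spd_unit//; apply: spd_sqrtm. Qed.

Lemma mul_isqrtm_sqrtm T : spd T -> isqrtm T *m sqrtm T = 1%:M.
Proof. by move=> pT; rewrite mulVmx// spd_unit//; apply: spd_sqrtm. Qed.

Lemma tr_sqrtm T : spd T -> (sqrtm T)^T = sqrtm T.
Proof. by move=> pT; apply/spd_sym/spd_sqrtm. Qed.

Lemma tr_whiten T v : spd T -> v^T = v -> (whiten T v)^T = whiten T v.
Proof. by move=> pT sv; rewrite /whiten !trmx_mul tr_isqrtm// sv mulmxA. Qed.

Lemma whiten_spd T S : spd T -> spd S -> spd (whiten T S).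
Proof.
move=> pT pS; rewrite /whiten -{2}(tr_isqrtm pT).
by apply: spd_congr => //; apply: isqrtm_unit.
Qed.

Lemma whitenK T S : spd T -> sqrtm T *m whiten T S *m sqrtm T = S.
Proof.
move=> pT; rewrite /whiten !mulmxA mul_sqrtm_isqrtm// mul1mx -mulmxA.
by rewrite mul_isqrtm_sqrtm// mulmx1.
Qed.

Lemma whiten_self T : spd T -> whiten T T = 1%:M.
Proof.
move=> pT; rewrite /whiten -[in X in _ *m X *m _](mul_sqrtm pT) mulmxA.
by rewrite mul_isqrtm_sqrtm// mul1mx mul_sqrtm_isqrtm.
Qed.

Lemma logm1 : logm (1%:M : 'M[R]_n) = 0.
Proof.
have s1 : (1%:M : 'M[R]_n)^T = 1%:M by rewrite trmx1.
rewrite logmE; last exact: spd1.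
transitivity (fmx (@ln R \o (fun=> 1)) (1%:M : 'M[R]_n)).
  by rewrite -fmx_comp// fmx_cst.
transitivity (fmx (fun=> 0) (1%:M : 'M[R]_n)); last by rewrite fmx_cst// raddf0.
by apply: eq_fmx => i /=; rewrite ln1.
Qed.

Lemma sqlog1 : sqlog (1%:M : 'M[R]_n) = 0.
Proof. by rewrite /sqlog logm1 fnorm0 expr0n. Qed.

Lemma fdot_logdiv T S v : spd T -> spd S -> v^T = v ->
  let G := isqrtm T *m sqrtm S in let w := whiten S v in
  \tr (logm (whiten T S) *m (invmx G^T *m w *m G^T)) =
    fdot (logdiv (whiten T S)) (whiten T v).
Proof.
move=> pT pS sv G w; have pZ := whiten_spd pT pS.
have Gu : G \in unitmx by rewrite unitmx_mul isqrtm_unit//= spd_unit//; apply: spd_sqrtm.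
have GG : G *m G^T = whiten T S.
  rewrite /G trmx_mul tr_isqrtm// tr_sqrtm// /whiten -{3}(mul_sqrtm pS).
  by rewrite !mulmxA.
have GwG : G *m w *m G^T = whiten T v.
  rewrite /G /w trmx_mul tr_isqrtm// tr_sqrtm// /whiten !mulmxA.
  rewrite -(mulmxA _ (sqrtm S) (isqrtm S)) mul_sqrtm_isqrtm// mulmx1.
  by rewrite -(mulmxA _ (isqrtm S) (sqrtm S)) mul_isqrtm_sqrtm// mulmx1.
have lt : (logdiv (whiten T S))^T = logdiv (whiten T S) by rewrite logdivE// tr_fmx.
rewrite /fdot lt /logdiv -[in RHS]mulmxA; congr (\tr (_ *m _)).
rewrite -GwG -GG.
have -> : invmx (G *m G^T) = invmx G^T *m invmx G.
  have e : (G *m G^T) *m (invmx G^T *m invmx G) = 1%:M.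
    by rewrite !mulmxA -(mulmxA G) mulmxV ?unitmx_tr// mulmx1 mulmxV.
  by have [U _] := mulmx1_unit e; rewrite -[RHS](mulKmx U) e mulmx1.
move: (G^T) (w) => Gt w'; move: {GwG GG w} G Gu => G Gu.
by rewrite -(mulmxA G w') -(mulmxA (invmx Gt) (invmx G)) mulKmx// mulmxA.
Qed.

(** The law of cosines in the triangle T, S, Exp_S u, moved to base point 1 by
    the isometry [whiten T]. *)
Lemma sqlog_exp_ge T S u : spd T -> spd S -> u^T = u ->
  sqlog (whiten T S) + 2 * fdot (logdiv (whiten T S)) (whiten T u)
  <= sqlog (whiten T (sqrtm S *m expm (isqrtm S *m u *m isqrtm S) *m sqrtm S)).
Proof.
move=> pT pS su; rewrite -fdot_logdiv//.
set G := isqrtm T *m sqrtm S; set w := whiten S u.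
have Gu : G \in unitmx by rewrite unitmx_mul isqrtm_unit//= spd_unit//; apply: spd_sqrtm.
have := cosine_law Gu (tr_whiten pS su : w^T = w).
have -> : G *m G^T = whiten T S.
  rewrite /G trmx_mul tr_isqrtm// tr_sqrtm// /whiten -{3}(mul_sqrtm pS).
  by rewrite !mulmxA.
have -> // : G *m expm w *m G^T =
  whiten T (sqrtm S *m expm (isqrtm S *m u *m isqrtm S) *m sqrtm S).
by rewrite /G trmx_mul tr_isqrtm// tr_sqrtm// /w /whiten !mulmxA.
Qed.

Lemma spd_pinched S : spd S -> exists2 c, 0 < c & pinched c S.
Proof.
move=> pS; exists (fnorm S + fnorm (invmx S) + 1).
  by rewrite ltr_wpDl// addr_ge0 ?fnorm_ge0.
apply: pinched_of_fnorm => //.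
- by rewrite ltr_wpDl// addr_ge0 ?fnorm_ge0.
- by rewrite -addrA lerDl addr_ge0 ?fnorm_ge0.
- by rewrite addrAC lerDr addr_ge0 ?fnorm_ge0.
Qed.

Lemma quad_abs_le A (x : 'cV[R]_n) : `|\tr (x^T *m A *m x)| <= fnorm A * fdot x x.
Proof.
rewrite -mulmxA -[\tr _]/(fdot x (A *m x)); apply: le_trans (cauchy_schwarz _ _) _.
rewrite -sqr_fnorm expr2 mulrCA ler_wpM2l ?fnorm_ge0//; exact: fnormM.
Qed.

Lemma pinched_of_quad a c A : A^T = A -> 0 < a -> a^-1 <= c ->
  (forall x : 'cV[R]_n, a * fdot x x <= \tr (x^T *m A *m x)) -> fnorm A <= c ->
  pinched c A.
Proof.
move=> sA a0 ac qA Ac; split=> // i; apply/andP; split; last first.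
  by apply: le_trans Ac; apply: le_trans (ler_norm _) _; exact: spec_abs_le.
apply: le_trans (spec_ge sA qA i); rewrite -[a]invrK lef_pV2 ?posrE ?invr_gt0//.
by apply: lt_le_trans ac; rewrite invr_gt0.
Qed.

Lemma pinched_near c S v : 0 < c -> pinched c S -> v^T = v ->
  exists c' t0, [/\ 0 < c', 0 < t0 & forall t, `|t| <= t0 -> pinched c' (S + t *: v)].
Proof.
move=> c0 pS sv; have f0 := fnorm_ge0 v.
(* For |t| <= t0 both |t| |v| <= 1 and |t| |v| <= 1/(2c),
   so that half of the lower bound 1/c survives. *)
pose c' := n%:R * c + 2 * c + 1; pose t0 := (2 * c * (fnorm v + 1) + fnorm v)^-1.
have nc : 0 <= n%:R * c by rewrite mulr_ge0 ?ler0n ?ltW.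
have t00 : 0 < 2 * c * (fnorm v + 1) + fnorm v.
  by rewrite ltr_wpDr// !mulr_gt0//; lra.
exists c', t0; split; [rewrite /c'; lra|by rewrite invr_gt0|].
move=> t; rewrite -(ler_pM2r t00) mulVf ?gt_eqF// mulrDr => tt.
have tv1 : `|t| * fnorm v <= 1.
  have : 0 <= `|t| * (2 * c * (fnorm v + 1)) by rewrite !mulr_ge0//; lra.
  lra.
have tv2 : `|t| * fnorm v <= (2 * c)^-1.
  rewrite -[leRHS]mul1r ler_pdivlMr; last lra.
  have : 0 <= `|t| * fnorm v by rewrite mulr_ge0.
  have : 0 <= `|t| * (2 * c) by rewrite mulr_ge0//; lra.
  have : `|t| * (2 * c * (fnorm v + 1)) = `|t| * fnorm v * (2 * c) + `|t| * (2 * c) by ring.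
  lra.
have [sS bS] := pS.
apply: (@pinched_of_quad (2 * c)^-1).
- by rewrite linearD/= linearZ/= sS sv.
- by rewrite invr_gt0; lra.
- by rewrite invrK /c'; lra.
- move=> x.
  have h1 : c^-1 * fdot x x <= \tr (x^T *m S *m x).
    by apply: quad_ge => // i; have /andP[] := bS i.
  have -> : \tr (x^T *m (S + t *: v) *m x) = \tr (x^T *m S *m x) + t * \tr (x^T *m v *m x).
    by rewrite mulmxDr mulmxDl mxtraceD -scalemxAr -scalemxAl mxtraceZ.
  have h2 : `|t * \tr (x^T *m v *m x)| <= (2 * c)^-1 * fdot x x.
    rewrite normrM; apply: le_trans (_ : `|t| * (fnorm v * fdot x x) <= _).
      by rewrite ler_wpM2l// quad_abs_le.
    by rewrite mulrA ler_wpM2r ?fdot_ge0.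
  have h3 : c^-1 = (2 * c)^-1 + (2 * c)^-1 by field; rewrite gt_eqF.
  move: h2; rewrite ler_norml => /andP[h2 _]; rewrite h3 mulrDl in h1; lra.
- apply: le_trans (fnormD _ _) _; rewrite fnormZ.
  have := pinched_fnorm c0 pS; rewrite /c'; lra.
Qed.

Lemma local_sqlog T S v : spd T -> spd S -> v^T = v ->
  exists K t0, [/\ 0 <= K, 0 < t0 & forall t, `|t| <= t0 ->
    spd (S + t *: v) /\
    `|sqlog (whiten T (S + t *: v)) - sqlog (whiten T S)
      - t * (2 * fdot (logdiv (whiten T S)) (whiten T v))| <= K * t ^+ 2].
Proof.
move=> pT pS sv.
have [c0 c0p pZ] := spd_pinched (whiten_spd pT pS).
have [c [t0 [c_gt0 t00 near1]]] := pinched_near c0p pZ (tr_whiten pT sv).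
have [e0 e0p pS'] := spd_pinched pS.
have [e [t1 [e_gt0 t10 near2]]] := pinched_near e0p pS' sv.
exists ((c ^+ 2 + 2 * c ^+ 3) * fnorm (whiten T v) ^+ 2), (Num.min t0 t1).
split; first by rewrite mulr_ge0 ?sqr_ge0// addr_ge0 ?mulr_ge0 ?exprn_ge0 ?ltW.
  by rewrite lt_min t00.
move=> t; rewrite le_min => /andP[tt0 tt1]; split.
  exact: pinched_spd e_gt0 (near2 _ tt1).
have p0 := near1 0; rewrite normr0 scale0r addr0 in p0.
have := sqlog_taylor c_gt0 (p0 (ltW t00)) (near1 _ tt0); rewrite whitenD.
have -> : whiten T S + t *: whiten T v - whiten T S = t *: whiten T v.
  by rewrite addrC addKr.
rewrite fdotZr [2 * _]mulrCA => h; apply: le_trans h _.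
by rewrite fnormZ exprMn real_normK ?num_real// [t ^+ 2 * _]mulrC [leLHS]mulrA.
Qed.

Lemma ln_det S : spd S -> ln (\det S) = \tr (logm S).
Proof.
move=> pS; have sS := spd_sym pS; rewrite det_spec// logmE// trace_fmx//.
apply: (proj2 (_ : 0 < \prod_i spec S i /\ _)).
elim/big_rec2: _ => [|i y x _ [y0 <-]]; first by rewrite ln1.
have s0 := spd_spec pS i; split; first by rewrite mulr_gt0.
by rewrite lnM.
Qed.

Lemma tr_invmx S : spd S -> (invmx S)^T = invmx S.
Proof. by move=> pS; rewrite (spd_inv pS).2 tr_fmx. Qed.

Definition gauss_cost A S := fdot A (invmx S) + ln (\det S).

Definition gauss_cost_grad A S := invmx S - invmx S *m A *m invmx S.

(** The logarithm of the determinant is a trace of logarithms, hence covered by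
    Klein's inequality; the other term follows from the resolvent identity
    Z^-1 - Y^-1 = - Z^-1 (Z - Y) Y^-1, used twice. *)
Lemma gauss_cost_taylor c A Y Z : 0 < c -> pinched c Y -> pinched c Z ->
  `|gauss_cost A Z - gauss_cost A Y - fdot (gauss_cost_grad A Y) (Z - Y)|
    <= (fnorm A * (c ^+ 2 * (n%:R * c)) + c ^+ 2) * fnorm (Z - Y) ^+ 2.
Proof.
move=> c0 pY pZ; have sY := pinched_spd c0 pY; have sZ := pinched_spd c0 pZ.
rewrite /gauss_cost !ln_det//.
have -> : fdot A (invmx Z) + \tr (logm Z) - (fdot A (invmx Y) + \tr (logm Y)) -
  fdot (gauss_cost_grad A Y) (Z - Y) =
  - fdot A ((invmx Z - invmx Y) *m (Z - Y) *m invmx Y) +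
  (\tr (logm Z) - \tr (logm Y) - fdot (invmx Y) (Z - Y)).
  have e1 : invmx Z - invmx Y = - (invmx Z *m (Z - Y) *m invmx Y).
    rewrite mulmxBr mulVmx ?spd_unit// mulmxBl mul1mx -mulmxA mulmxV ?spd_unit//.
    by rewrite mulmx1 opprB.
  have e2 : fdot (gauss_cost_grad A Y) (Z - Y) = fdot (invmx Y) (Z - Y)
      - fdot A (invmx Y *m (Z - Y) *m invmx Y).
    by rewrite fdotBl fdotMr fdotMl !tr_invmx// mulmxA.
  have e3 : fdot A (invmx Z) - fdot A (invmx Y) = - fdot A (invmx Z *m (Z - Y) *m invmx Y).
    by rewrite -fdotBr e1 fdotNr.
  rewrite e2 (mulmxBl (invmx Z)) (mulmxBl (invmx Z *m _)) (fdotBr A).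
  move: e3; move: (fdot A (invmx Z)) (fdot A (invmx Y)) => x y.
  by clear e1 e2; move=> e3; lra.
apply: le_trans (ler_normD _ _) _; rewrite normrN [leRHS]mulrDl; apply: lerD; last first.
  exact: tr_logm_taylor.
apply: le_trans (cauchy_schwarz _ _) _; rewrite -[leRHS]mulrA ler_wpM2l ?fnorm_ge0//.
apply: le_trans (fnormM _ _) _.
rewrite [leRHS](_ : _ = c ^+ 2 * fnorm (Z - Y) * fnorm (Z - Y) * (n%:R * c)); last by ring.
rewrite ler_pM ?fnorm_ge0 ?pinched_fnorm_inv//.
apply: le_trans (fnormM _ _) _; rewrite ler_wpM2r ?fnorm_ge0//.
exact: invmx_lipschitz.
Qed.

Lemma local_gauss_cost A S v : spd S -> v^T = v ->
  exists K t0, [/\ 0 <= K, 0 < t0 & forall t, `|t| <= t0 ->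
    `|gauss_cost A (S + t *: v) - gauss_cost A S - t * fdot (gauss_cost_grad A S) v| <= K * t ^+ 2].
Proof.
move=> pS sv; have [c0 c0p pZ] := spd_pinched pS.
have [c [t0 [c_gt0 t00 near1]]] := pinched_near c0p pZ sv.
exists ((fnorm A * (c ^+ 2 * (n%:R * c)) + c ^+ 2) * fnorm v ^+ 2), t0; split => //.
  by rewrite mulr_ge0 ?sqr_ge0// addr_ge0 ?sqr_ge0// !mulr_ge0 ?fnorm_ge0 ?sqr_ge0 ?ler0n ?(ltW c_gt0).
move=> t tt0; have p0 := near1 0; rewrite normr0 scale0r addr0 in p0.
have := gauss_cost_taylor A c_gt0 (p0 (ltW t00)) (near1 _ tt0).
have -> : S + t *: v - S = t *: v by rewrite addrC addKr.
rewrite fdotZr => h; apply: le_trans h _.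
by rewrite fnormZ exprMn real_normK ?num_real// [t ^+ 2 * _]mulrC [leLHS]mulrA.
Qed.

End Geometry.

(** * Geodesic balls and first-order optimality *)

Section GeodesicBall.
Context {R : realType} {n : nat}.
Implicit Types (S T A Z v u : 'M[R]_n).

Definition ball_spd T (b : R) : set 'M[R]_n :=
  [set S | spd S /\ sqlog (whiten T S) <= b].

Lemma pinched_fnorm_sqrt c T : 0 < c -> pinched c T ->
  fnorm (sqrtm T) <= n%:R * Num.sqrt c.
Proof.
move=> c0 pT; have sT := pinched_spd c0 pT; rewrite sqrtmE//.
have [yT bT] := pT; apply: fnorm_fmx_le => // i; rewrite ger0_norm ?sqrtr_ge0//.
by have /andP[_ h] := bT i; rewrite ler_sqrt// ltW.
Qed.

Lemma pinched_fnorm_isqrt c T : 0 < c -> pinched c T ->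
  fnorm (isqrtm T) <= n%:R * Num.sqrt c.
Proof.
move=> c0 pT; have sT := pinched_spd c0 pT; rewrite isqrtmE//.
have [yT bT] := pT; apply: fnorm_fmx_le => // i.
rewrite ger0_norm ?invr_ge0 ?sqrtr_ge0//.
have s0 := spd_spec sT i; have /andP[h _] := bT i.
rewrite -sqrtrV ?(ltW s0)// ler_sqrt ?(ltW c0)//.
by rewrite -[leRHS]invrK lef_pV2 ?posrE ?invr_gt0.
Qed.

Lemma fnorm_sandwich (A B C : 'M[R]_n) a b x :
  fnorm A <= a -> fnorm B <= x -> fnorm C <= b -> fnorm (A *m B *m C) <= a * x * b.
Proof.
move=> hA hB hC; apply: le_trans (fnormM _ _) _; rewrite ler_pM ?fnorm_ge0//.
by apply: le_trans (fnormM _ _) _; rewrite ler_pM ?fnorm_ge0.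
Qed.

Lemma invmx_whiten T S : spd T -> spd S ->
  invmx (whiten T S) = sqrtm T *m invmx S *m sqrtm T.
Proof.
move=> pT pS; have e : whiten T S *m (sqrtm T *m invmx S *m sqrtm T) = 1%:M.
  rewrite /whiten !mulmxA -(mulmxA _ (isqrtm T) (sqrtm T)) mul_isqrtm_sqrtm// mulmx1.
  by rewrite -(mulmxA _ S) mulmxV ?spd_unit// mulmx1 mul_isqrtm_sqrtm.
by have [U _] := mulmx1_unit e; rewrite -[RHS](mulKmx U) e mulmx1.
Qed.

Lemma fnorm_whiten c T v : 0 < c -> pinched c T ->
  fnorm (whiten T v) <= (n%:R * Num.sqrt c) ^+ 2 * fnorm v.
Proof.
move=> c0 pT; rewrite expr2 -mulrA [leRHS]mulrC.
have h := pinched_fnorm_isqrt c0 pT.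
rewrite [leRHS](_ : _ = n%:R * Num.sqrt c * fnorm v * (n%:R * Num.sqrt c)); last by ring.
exact: fnorm_sandwich.
Qed.

Lemma whiten_pinched c : 0 < c -> exists2 c', 0 < c' &
  forall T S, pinched c T -> pinched c S -> pinched c' (whiten T S).
Proof.
move=> c0; pose b : R := n%:R * Num.sqrt c.
have b0 : 0 <= b * (n%:R * c) * b.
  by rewrite !mulr_ge0 ?sqrtr_ge0 ?ler0n ?(ltW c0).
exists (b * (n%:R * c) * b + 1); first by rewrite ltr_wpDl.
move=> T S pT pS; have [sT sS] := (pinched_spd c0 pT, pinched_spd c0 pS).
have le : b * (n%:R * c) * b <= b * (n%:R * c) * b + 1 by rewrite lerDl.
apply: pinched_of_fnorm; rewrite ?ltr_wpDl//.
- exact: whiten_spd.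
- apply: le_trans le; apply: fnorm_sandwich.
  + exact: pinched_fnorm_isqrt.
  + exact: pinched_fnorm.
  + exact: pinched_fnorm_isqrt.
- rewrite invmx_whiten//; apply: le_trans le.
  apply: fnorm_sandwich.
  + exact: pinched_fnorm_sqrt.
  + exact: pinched_fnorm_inv.
  + exact: pinched_fnorm_sqrt.
Qed.

Lemma ball_spd_pinched T b : spd T -> exists2 c, 0 < c &
  forall S, ball_spd T b S -> pinched c S.
Proof.
move=> pT; pose r := Num.sqrt b; pose k := expR r.
have k0 : 0 < k by exact: expR_gt0.
pose m := fnorm (sqrtm T) * (n%:R * k) * fnorm (sqrtm T) +
          fnorm (isqrtm T) * (n%:R * k) * fnorm (isqrtm T) + 1.
have p1 : 0 <= fnorm (sqrtm T) * (n%:R * k) * fnorm (sqrtm T).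
  by rewrite !mulr_ge0 ?fnorm_ge0 ?ler0n ?(ltW k0).
have p2 : 0 <= fnorm (isqrtm T) * (n%:R * k) * fnorm (isqrtm T).
  by rewrite !mulr_ge0 ?fnorm_ge0 ?ler0n ?(ltW k0).
have m0 : 0 < m by rewrite /m; lra.
exists m => // S [pS Sb]; have pZ := whiten_spd pT pS; have sZ := spd_sym pZ.
have pk : pinched k (whiten T S).
  split=> // i; have s0 := spd_spec pZ i.
  have : `|ln (spec (whiten T S) i)| <= r.
    apply: le_trans (fnorm_fmx_ge (@ln R) i sZ) _; rewrite -logmE//.
    have b0 : 0 <= b by apply: le_trans Sb; rewrite sqr_ge0.
    by rewrite /r -[leLHS]ger0_norm ?fnorm_ge0// -sqrtr_sqr ler_sqrt.
  rewrite ler_norml => /andP[h1 h2].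
  by rewrite /k -expRN -[spec _ _]lnK ?posrE// !ler_expR h1.
apply: pinched_of_fnorm => //.
- rewrite -(whitenK S pT).
  apply: (@le_trans _ _ (fnorm (sqrtm T) * (n%:R * k) * fnorm (sqrtm T))); last first.
    by rewrite /m; lra.
  by apply: fnorm_sandwich => //; apply: pinched_fnorm.
- have -> : invmx S = isqrtm T *m invmx (whiten T S) *m isqrtm T.
    rewrite invmx_whiten// !mulmxA mul_isqrtm_sqrtm// mul1mx -mulmxA.
    by rewrite mul_sqrtm_isqrtm// mulmx1.
  apply: (@le_trans _ _ (fnorm (isqrtm T) * (n%:R * k) * fnorm (isqrtm T))); last first.
    by rewrite /m; lra.
  by apply: fnorm_sandwich => //; apply: pinched_fnorm_inv.
Qed.

Lemma ge0_of_near (D K t0 : R) : 0 < t0 ->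
  (forall t, 0 < t -> t <= t0 -> 0 <= D + K * t) -> 0 <= D.
Proof.
move=> t00 h; rewrite leNgt; apply/negP => D0.
have k1 : 0 < 2 * (`|K| + 1) by rewrite mulr_gt0// ltr_wpDl.
pose t := Num.min t0 (- D / (2 * (`|K| + 1))).
have tp : 0 < t by rewrite lt_min t00 divr_gt0// oppr_gt0.
have := h t tp; rewrite ge_min lexx => /(_ isT).
have : t * (2 * (`|K| + 1)) <= - D by rewrite -ler_pdivlMr// ge_min lexx orbT.
have : K * t <= `|K| * t by rewrite ler_wpM2r ?ler_norm// ltW.
have -> : t * (2 * (`|K| + 1)) = 2 * (`|K| * t) + 2 * t by ring.
move: tp D0; move: (K * t) (`|K| * t) => x y *; lra.
Qed.

(** The constraint along a perturbed direction: the values s, d and y stand for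
    the squared distance to the center, its derivative along the unperturbed
    direction and its value after a step t.  The perturbation lowers the
    derivative by 2 e s, which beats K t^2 when s is near the bound c; when s is
    far from c the slack c - s does. *)
Lemma feasible_arith (c s d e t K y : R) : 0 <= s -> s <= c -> d <= c - s ->
  0 < t -> 0 <= e -> t <= 2^-1 -> 4 * e * t <= 1 -> K * t <= 2 * e * c ->
  y <= s + t * (d - 2 * e * s) + K * t ^+ 2 -> y <= c.
Proof.
move=> s0 sc dc t0 e0 t2 t4 Kt hy; apply: le_trans hy _.
have cs : 0 <= c - s by lra.
have p1 : t * d <= t * (c - s) by rewrite ler_wpM2l// ltW.
have p2 : 0 <= (c - s) * (2^-1 - t) by rewrite mulr_ge0//; lra.
have p3 : 0 <= (c - s) * (1 - 4 * e * t) by rewrite mulr_ge0//; lra.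
have p4 : t * (K * t) <= t * (2 * e * c) by rewrite ler_wpM2l// ltW.
have -> : s + t * (d - 2 * e * s) + K * t ^+ 2 = s + t * d - t * (2 * e * s) + t * (K * t) by ring.
lra.
Qed.

Lemma fdot_logdiv_dilation (Z : 'M[R]_n) : spd Z -> fdot (logdiv Z) (Z *m logm Z) = sqlog Z.
Proof.
move=> pZ; have lt : (logdiv Z)^T = logdiv Z by rewrite logdivE// tr_fmx.
rewrite /fdot lt /logdiv mulmxA mulmxKV ?spd_unit// /sqlog sqr_fnorm /fdot.
by rewrite logmE// tr_fmx.
Qed.

(** By the law of cosines, u satisfies the linearized constraint, though possibly
    with equality.  Subtracting eps times the radial direction e makes the
    inequality strict, so that the segment issued from S1 is feasible for small
    positive t; D is the derivative of the minimized function. *)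
Lemma prox_first_order T S0 S1 A u (b lam : R) : 0 < b -> 0 <= lam ->
  spd T -> spd S0 -> ball_spd T b S1 ->
  (forall S, ball_spd T b S ->
     gauss_cost A S1 + lam * sqlog (whiten S0 S1) <= gauss_cost A S + lam * sqlog (whiten S0 S)) ->
  u^T = u -> ball_spd T b (sqrtm S1 *m expm (isqrtm S1 *m u *m isqrtm S1) *m sqrtm S1) ->
  0 <= fdot (gauss_cost_grad A S1) u
       + lam * (2 * fdot (logdiv (whiten S0 S1)) (whiten S0 u)).
Proof.
move=> b0 lam0 pT pS0 [pS1 S1b] S1min su [_ ub].
set Z := whiten T S1 in S1b.
have pZ : spd Z by exact: whiten_spd.
pose D v := fdot (gauss_cost_grad A S1) v
       + lam * (2 * fdot (logdiv (whiten S0 S1)) (whiten S0 v)).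
(* The velocity at S1 of the geodesic that goes away from T. *)
pose e := sqrtm T *m (Z *m logm Z) *m sqrtm T.
have sZl : (Z *m logm Z)^T = Z *m logm Z.
  have sZ := spd_sym pZ; rewrite logmE//.
  rewrite -[X in (X *m _)^T](fmx_id sZ) -[X in _ = X *m _](fmx_id sZ).
  by rewrite fmxM// tr_fmx.
have colorT (X : 'M[R]_n) : X^T = X ->
    (sqrtm T *m X *m sqrtm T)^T = sqrtm T *m X *m sqrtm T.
  by move=> sX; rewrite !trmx_mul tr_sqrtm// sX mulmxA.
have colorK (X : 'M[R]_n) : whiten T (sqrtm T *m X *m sqrtm T) = X.
  rewrite /whiten !mulmxA mul_isqrtm_sqrtm// mul1mx -mulmxA.
  by rewrite mul_sqrtm_isqrtm// mulmx1.
have se : e^T = e by exact: colorT.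
have we : whiten T e = Z *m logm Z by exact: colorK.
have hu : 2 * fdot (logdiv Z) (whiten T u) <= b - sqlog Z.
  have := sqlog_exp_ge pT pS1 su; rewrite -/Z => h; rewrite lerBrDl.
  exact: le_trans h ub.
have DB w x t : D (w + t *: x) = D w + t * D x.
  by rewrite /D whitenD !fdotDr !fdotZr; ring.
suff De eps : 0 < eps -> 0 <= D u + - D e * eps.
  by apply: (@ge0_of_near _ (- D e) 1) => // t t0 _; apply: De.
move=> eps0; pose v := u + (- eps) *: e.
have sv : v^T = v by rewrite /v linearD/= linearZ/= su se.
have -> : D u + - D e * eps = D v by rewrite /v DB; ring.
have [K1 [t1 [K10 t10 h1]]] := local_sqlog pT pS1 sv.
have [K2 [t2 [K20 t20 h2]]] := local_sqlog pS0 pS1 sv.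
have [K3 [t3 [K30 t30 h3]]] := local_gauss_cost A pS1 sv.
(* The three upper bounds on t that [feasible_arith] asks for. *)
pose t4 := Num.min 2^-1 (Num.min (4 * eps)^-1 (2 * eps * b / (K1 + 1))).
have t40 : 0 < t4.
  by rewrite !lt_min invr_gt0 ltr0n invr_gt0 !divr_gt0 ?mulr_gt0// ltr_wpDl.
apply: (@ge0_of_near _ (K3 + lam * K2) (Num.min (Num.min t1 t2) (Num.min t3 t4))).
  by rewrite lt_min; apply/andP; split; rewrite lt_min; apply/andP.
move=> t t0; rewrite !le_min => /andP[/andP[tt1 tt2] /and4P[tt3 tt4 tt5 tt6]].
have tn : `|t| = t by rewrite gtr0_norm.
have [pSt] := h1 t ltac:(by rewrite tn); rewrite -/Z ler_norml => /andP[_ f1].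
have [_] := h2 t ltac:(by rewrite tn); rewrite ler_norml => /andP[_ f2].
have := h3 t ltac:(by rewrite tn); rewrite ler_norml => /andP[_ f3].
have bt : sqlog (whiten T (S1 + t *: v)) <= b.
  have wv : 2 * fdot (logdiv Z) (whiten T v) =
      2 * fdot (logdiv Z) (whiten T u) - 2 * eps * sqlog Z.
    by rewrite /v whitenD we fdotDr fdotZr fdot_logdiv_dilation//; ring.
  apply: (@feasible_arith _ (sqlog Z) (2 * fdot (logdiv Z) (whiten T u)) eps t K1) => //.
  - by rewrite sqr_ge0.
  - exact: ltW.
  - rewrite mulrC -(@ler_pdivlMr _ (4 * eps)) ?mul1r ?mulr_gt0//.
  - have : (K1 + 1) * t <= 2 * eps * b by rewrite mulrC -ler_pdivlMr// ltr_wpDl.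
    by apply: le_trans; rewrite ler_wpM2r ?(ltW t0)// lerDl.
  - by rewrite -wv -lerBlDl opprD addrA.
have := S1min _ (conj pSt bt); rewrite -(pmulr_rge0 _ t0).
have lf2 : lam * (sqlog (whiten S0 (S1 + t *: v)) - sqlog (whiten S0 S1) -
   t * (2 * fdot (logdiv (whiten S0 S1)) (whiten S0 v))) <= lam * (K2 * t ^+ 2).
  by rewrite ler_wpM2l.
rewrite /D; clear -f3 lf2; move: f3 lf2.
move: (gauss_cost _ _) (gauss_cost _ _) (sqlog _) (sqlog _) (fdot _ _) (fdot _ _) => x1 x2 x3 x4 x5 x6.
rewrite !mulrBr => f3 lf2 h.
have -> : t * (x6 + lam * (2 * x5) + (K3 + lam * K2) * t) =
  t * x6 + lam * (t * (2 * x5)) + K3 * t ^+ 2 + lam * (K2 * t ^+ 2) by ring.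
lra.
Qed.

Lemma sqlog_lipschitz c (Y Z : 'M[R]_n) : 0 < c -> pinched c Y -> pinched c Z ->
  `|sqlog Z - sqlog Y| <= 2 * n%:R * c ^+ 2 * fnorm (Z - Y).
Proof.
move=> c0 pY pZ; rewrite /sqlog !sqr_fnorm.
have -> : fdot (logm Z) (logm Z) - fdot (logm Y) (logm Y) =
    fdot (logm Z - logm Y) (logm Z + logm Y).
  by rewrite fdotBl !fdotDr (fdotC (logm Y) (logm Z)); ring.
apply: le_trans (cauchy_schwarz _ _) _.
have -> : 2 * n%:R * c ^+ 2 * fnorm (Z - Y) = (c * fnorm (Z - Y)) * (n%:R * c + n%:R * c).
  by ring.
rewrite ler_pM ?fnorm_ge0//; first exact: logm_lipschitz.
by apply: le_trans (fnormD _ _) _; rewrite lerD// pinched_fnorm_log.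
Qed.

Lemma fnorm_fmx_mono g h K A : A^T = A -> 0 <= K ->
  (forall i, `|g (spec A i)| <= K * `|h (spec A i)|) ->
  fnorm (fmx g A) <= K * fnorm (fmx h A).
Proof.
move=> sA K0 gh; rewrite -[leLHS]ger0_norm ?fnorm_ge0//.
rewrite -[leRHS]ger0_norm ?mulr_ge0 ?fnorm_ge0//.
rewrite -!sqrtr_sqr ler_sqrt ?sqr_ge0// exprMn !fnorm_fmx// mulr_sumr.
apply: ler_sum => i _; rewrite -exprMn.
rewrite -[leLHS]real_normK ?num_real// -[leRHS]real_normK ?num_real//.
by rewrite lerXn2r ?nnegrE// normrM (ger0_norm K0).
Qed.

Lemma pinched_sub1_le c Z : 0 < c -> pinched c Z ->
  fnorm (Z - 1%:M) <= c * fnorm (logm Z).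
Proof.
move=> c0 pZ; have sZ := pinched_spd c0 pZ; have [yZ bZ] := pZ.
have -> : Z - 1%:M = fmx (fun t => t - 1) Z.
  rewrite -[X in X - _](fmx_id yZ) -(fmx_cst 1 yZ) -scaleN1r -fmxZ !fmx_rank1.
  by rewrite -big_split/=; apply: eq_bigr => i _; rewrite -scalerDl mulN1r.
rewrite logmE//; apply: fnorm_fmx_mono => //; first exact: ltW.
move=> i; have s0 := spd_spec sZ i; have /andP[h1 h2] := bZ i.
move: (spec Z i) s0 h1 h2 => z z0 h1 h2.
have c1 : 1 <= c.
  rewrite leNgt; apply/negP => c1; have : 1 < c^-1 by rewrite invf_gt1.
  have := le_trans h1 h2; lra.
have l1 : ln z <= z - 1.
  by have := ln_sub_le (@ltr01 R) z0; rewrite ln1 subr0 divr1.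
have l2 : - ln z <= (1 - z) / z.
  by have := ln_sub_le z0 (@ltr01 R); rewrite ln1 sub0r.
have l3 : z - 1 <= z * ln z.
  have : z * - ln z <= 1 - z by rewrite mulrC -ler_pdivlMr.
  rewrite mulrN; lra.
have [z1|z1] := leP 1 z.
  have lz : 0 <= ln z by rewrite ln_ge0.
  rewrite !ger0_norm ?subr_ge0//; apply: le_trans l3 _; rewrite ler_wpM2r//.
have lz : ln z <= 0 by rewrite ln_le0// ltW.
rewrite !ler0_norm ?subr_le0 ?(ltW z1)//.
have : 1 * (- ln z) <= c * (- ln z) by rewrite ler_wpM2r// oppr_ge0.
lra.
Qed.

Lemma fnorm_sub_le_log c T S : 0 < c -> pinched c T -> pinched c (whiten T S) ->
  fnorm (S - T) <= (n%:R * Num.sqrt c) ^+ 2 * c * fnorm (logm (whiten T S)).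
Proof.
move=> c0 pT pZ; have sT := pinched_spd c0 pT.
have -> : S - T = sqrtm T *m (whiten T S - 1%:M) *m sqrtm T.
  by rewrite mulmxBr mulmxBl whitenK// mulmx1 mul_sqrtm.
rewrite [leRHS](_ : _ = n%:R * Num.sqrt c * (c * fnorm (logm (whiten T S)))
   * (n%:R * Num.sqrt c)); last by ring.
by apply: fnorm_sandwich; rewrite ?pinched_fnorm_sqrt ?pinched_sub1_le.
Qed.

Lemma whiten_lipschitz c : 0 < c -> exists2 L, 0 <= L & forall T T' S S',
  pinched c T -> pinched c T' -> pinched c S -> pinched c S' ->
  fnorm (whiten T S - whiten T' S') <= L * (fnorm (T - T') + fnorm (S - S')).
Proof.
move=> c0; pose b : R := n%:R * Num.sqrt c; pose l := Num.sqrt c ^+ 3; pose a : R := n%:R * c.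
have [b0 l0 a0] : [/\ 0 <= b, 0 <= l & 0 <= a].
  by rewrite /b /l /a exprn_ge0 ?mulr_ge0 ?sqrtr_ge0 ?ler0n ?(ltW c0).
exists (2 * l * a * b + b * b); first by
  rewrite addr_ge0 ?mulr_ge0 ?exprn_ge0 ?sqrtr_ge0 ?ler0n ?(ltW c0).
move=> T T' S S' pT pT' pS pS'.
have -> : whiten T S - whiten T' S' =
    (isqrtm T - isqrtm T') *m S *m isqrtm T + isqrtm T' *m S *m (isqrtm T - isqrtm T')
    + isqrtm T' *m (S - S') *m isqrtm T'.
  rewrite /whiten !mulmxBl !mulmxBr !mulmxBl.
  move: (isqrtm T *m S *m isqrtm T) (isqrtm T' *m S *m isqrtm T) => x1 x2.
  move: (isqrtm T' *m S *m isqrtm T') (isqrtm T' *m S' *m isqrtm T') => x3 x4.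
  by rewrite !subrKA.
have bT := pinched_fnorm_isqrt c0 pT; have bT' := pinched_fnorm_isqrt c0 pT'.
have aS := pinched_fnorm c0 pS.
have d := isqrtm_lipschitz c0 pT' pT.
apply: le_trans (fnormD _ _) _.
apply: le_trans (lerD (fnormD _ _) (lexx _)) _.
have h1 := fnorm_sandwich d aS bT; have h2 := fnorm_sandwich bT' aS d.
have h3 := fnorm_sandwich bT' (lexx (fnorm (S - S'))) bT'.
apply: le_trans (lerD (lerD h1 h2) h3) _.
rewrite -/b -/l -/a; set x := fnorm _; set y := fnorm _.
have x0 : 0 <= x by exact: fnorm_ge0. have y0 : 0 <= y by exact: fnorm_ge0.
rewrite -subr_ge0 [leRHS](_ : _ = b * b * x + 2 * l * a * b * y); last by ring.
by rewrite addr_ge0 ?mulr_ge0 ?exprn_ge0 ?sqrtr_ge0 ?ler0n ?(ltW c0).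
Qed.

Lemma gauss_cost_lipschitz c A S S' : 0 < c -> pinched c S -> pinched c S' ->
  `|gauss_cost A S - gauss_cost A S'| <=
     (fnorm A * c ^+ 2 + fnorm (1%:M : 'M[R]_n) * c) * fnorm (S - S').
Proof.
move=> c0 pS pS'; have [sS sS'] := (pinched_spd c0 pS, pinched_spd c0 pS').
rewrite /gauss_cost !ln_det//.
have -> : fdot A (invmx S) + \tr (logm S) - (fdot A (invmx S') + \tr (logm S')) =
  fdot A (invmx S - invmx S') + fdot 1%:M (logm S - logm S').
  by rewrite !fdotBr /fdot trmx1 !mul1mx; ring.
apply: le_trans (ler_normD _ _) _; rewrite [leRHS]mulrDl.
rewrite -(mulrA (fnorm A)) -(mulrA (fnorm 1%:M)); apply: lerD;
  apply: le_trans (cauchy_schwarz _ _) _; rewrite ler_wpM2l ?fnorm_ge0//.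
  exact: invmx_lipschitz.
exact: logm_lipschitz.
Qed.

Lemma gauss_cost_lipschitz_data c A A' S : 0 < c -> pinched c S ->
  `|gauss_cost A S - gauss_cost A' S| <= n%:R * c * fnorm (A - A').
Proof.
move=> c0 pS; rewrite /gauss_cost opprD addrACA subrr addr0 -fdotBl.
apply: le_trans (cauchy_schwarz _ _) _; rewrite [leRHS]mulrC ler_wpM2l ?fnorm_ge0//.
exact: pinched_fnorm_inv.
Qed.

End GeodesicBall.

(** * The Gaussian objective and its gradients *)

Section Problem.
Context {R : realType} {N M : nat}.
Variable x : 'I_M -> 'cV[R]_N.
Implicit Types (mu u v : 'cV[R]_N) (S : 'M[R]_N).

Lemma fnorm_sum (I : Type) (r : seq I) m n (F : I -> 'M[R]_(m, n)) :
  fnorm (\sum_(i <- r) F i) <= \sum_(i <- r) fnorm (F i).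
Proof.
elim/big_rec2: _ => [|i y X _ h]; first by rewrite fnorm0.
by apply: le_trans (fnormD _ _) _; rewrite lerD2l.
Qed.

Lemma fnorm_avg m n (F : 'I_M -> 'M[R]_(m, n)) b : 0 <= b ->
  (forall j, fnorm (F j) <= b) -> fnorm (M%:R^-1 *: \sum_j F j) <= b.
Proof.
move=> b0 Fb; rewrite fnormZ ger0_norm ?invr_ge0//.
apply: le_trans (_ : M%:R^-1 * (M%:R * b) <= _).
  rewrite ler_wpM2l ?invr_ge0//; apply: le_trans (fnorm_sum _ _) _.
  apply: le_trans (ler_sum _ (fun j _ => Fb j)) _.
  by rewrite sumr_const card_ord -[b *+ M]mulr_natl.
rewrite mulrA; have [->|M0] := eqVneq (M%:R : R) 0; first by rewrite mulr0 mul0r.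
by rewrite mulVf// mul1r.
Qed.

(** The linear and the quadratic part of u |-> scatter (mu + u). *)
Definition dscatter mu u : 'M[R]_N :=
  M%:R^-1 *: \sum_(j < M) - (u *m (x j - mu)^T + (x j - mu) *m u^T).

Definition qscatter u : 'M[R]_N := M%:R^-1 *: \sum_(j < M) u *m u^T.

Lemma scatterD mu u : scatter x (mu + u) = scatter x mu + dscatter mu u + qscatter u.
Proof.
rewrite /scatter /dscatter /qscatter -!scalerDr -!big_split/=; congr (_ *: _).
apply: eq_bigr => j _; rewrite opprD addrA; move: (x j - mu) => y.
rewrite linearB/= mulmxBl !mulmxBr.
move: (y *m y^T) (y *m u^T) (u *m y^T) (u *m u^T) => a b c d.
by rewrite opprB opprD !addrA addrAC [a - b - c]addrAC.
Qed.

Lemma dscatterZ mu t u : dscatter mu (t *: u) = t *: dscatter mu u.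
Proof.
rewrite /dscatter [RHS]scalerA mulrC -[RHS]scalerA; congr (_ *: _); rewrite scaler_sumr.
apply: eq_bigr => j _.
by rewrite linearZ/= -scalemxAl -scalemxAr -scalerDr scalerN.
Qed.

Lemma qscatterZ t u : qscatter (t *: u) = t ^+ 2 *: qscatter u.
Proof.
rewrite /qscatter [RHS]scalerA mulrC -[RHS]scalerA; congr (_ *: _); rewrite scaler_sumr.
by apply: eq_bigr => j _; rewrite linearZ/= -scalemxAl -scalemxAr scalerA expr2.
Qed.

Lemma tr_scatter mu : (scatter x mu)^T = scatter x mu.
Proof.
rewrite /scatter linearZ/= linear_sum/=; congr (_ *: _).
by apply: eq_bigr => j _; rewrite trmx_mul trmxK.
Qed.

Definition mean_grad mu S : 'cV[R]_N :=
  M%:R^-1 *: \sum_(j < M) (-2) *: (invmx S *m (x j - mu)).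

Lemma mean_gradE mu S u : spd S ->
  fdot (mean_grad mu S) u = fdot (dscatter mu u) (invmx S).
Proof.
move=> pS; have sP := tr_invmx pS; rewrite /mean_grad /dscatter !fdotZl; congr (_ * _).
have fdot_suml m n (F : 'I_M -> 'M[R]_(m, n)) C : fdot (\sum_j F j) C = \sum_j fdot (F j) C.
  elim/big_rec2: _ => [|j y X _ <-]; last by rewrite fdotDl.
  by rewrite /fdot trmx0 mul0mx mxtrace0.
rewrite !fdot_suml; apply: eq_bigr => j _; move: (x j - mu) => y.
rewrite fdotZl fdotNl fdotDl (fdotMr u) (fdotMr y) !trmxK (fdotC u).
by rewrite !(fdotMl (invmx S) y) sP; ring.
Qed.

Lemma derive_of_taylor (V : normedModType R) (h : V -> R) (a v : V) (D K t0 : R) :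
  0 < t0 -> (forall t, `|t| <= t0 -> `|h (a + t *: v) - h a - t * D| <= K * t ^+ 2) ->
  'D_v (h : V -> R^o) a = D.
Proof.
move=> t00 hT; apply: cvg_lim => //.
apply/cvgrPdist_le => e e0; near=> t.
have t_neq0 : t != 0 by near: t; exact: nbhs_dnbhs_neq.
have tt0 : `|t| <= t0.
  near: t; apply: dnbhs0_le; exact: t00.
have te : `|t| <= e / (`|K| + 1).
  near: t; apply: dnbhs0_le; by rewrite divr_gt0// ltr_wpDl.
have -> : D - t^-1 *: ((h \o shift a) (t *: v) - h a) =
   - (t^-1 * (h (a + t *: v) - h a - t * D)).
  by rewrite /= /shift [t *: v + a]addrC /GRing.scale/=; field.
rewrite normrN normrM normfV ler_pdivrMl ?normr_gt0//.
apply: le_trans (hT _ tt0) _; rewrite -real_normK ?num_real// expr2 mulrCA.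
rewrite ler_wpM2l//; move: te; rewrite ler_pdivlMr ?ltr_wpDl//.
have : K * `|t| <= `|K| * `|t| by rewrite ler_wpM2r ?ler_norm.
have := normr_ge0 t; rewrite mulrDr mulr1 [`|t| * _]mulrC; lra.
Unshelve. all: by end_near.
Qed.

Lemma objectiveE mu S : objective x mu S = gauss_cost (scatter x mu) S.
Proof. by []. Qed.

Lemma objective_mean_taylor mu S u t :
  objective x (mu + t *: u) S - objective x mu S =
  t * fdot (dscatter mu u) (invmx S) + t ^+ 2 * fdot (qscatter u) (invmx S).
Proof.
rewrite !objectiveE /gauss_cost scatterD dscatterZ qscatterZ !fdotDl (fdotZl t) (fdotZl (t ^+ 2)).
by ring.
Qed.

Lemma derive_mean mu S u :
  'D_u ((fun m => objective x m S) : 'cV[R]_N -> R^o) mu = fdot (dscatter mu u) (invmx S).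
Proof.
apply: (@derive_of_taylor _ _ _ _ _ `|fdot (qscatter u) (invmx S)| 1) => // t _.
rewrite objective_mean_taylor addrC addKr normrM mulrC.
by rewrite (ger0_norm (sqr_ge0 t)).
Qed.

Lemma derive_cov mu S (v : 'M[R]_N) : spd S -> v^T = v ->
  'D_v (objective x mu : 'M[R]_N -> R^o) S = fdot (gauss_cost_grad (scatter x mu) S) v.
Proof.
move=> pS sv; have [K [t0 [K0 t00 h]]] := local_gauss_cost (scatter x mu) pS sv.
exact: derive_of_taylor t00 h.
Qed.

(** The gradient is chosen by its defining property, so it suffices to exhibit
    one vector with this property. *)
Lemma metric_rgrad_mean mu S u : spd S ->
  metric (euclidean N) mu (rgrad (euclidean N) (fun m => objective x m S) mu) u =
  fdot (dscatter mu u) (invmx S).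
Proof.
move=> pS; rewrite -derive_mean /rgrad.
case: xgetP => [G _ [_ /(_ u I)]//|/(_ (mean_grad mu S))]; case; split => // v _.
by rewrite derive_mean -mean_gradE.
Qed.

(** In the Fisher-Rao metric the gradient is 2 (S - scatter mu), because
    S^-1 (S - A) S^-1 is the Euclidean gradient of the cost. *)
Lemma metric_rgrad_cov mu S (u : 'M[R]_N) : spd S -> u^T = u ->
  metric (fisher_rao N) S (rgrad (fisher_rao N) (objective x mu) S) u =
  fdot (gauss_cost_grad (scatter x mu) S) u.
Proof.
move=> pS su; rewrite -derive_cov// /rgrad.
case: xgetP => [G _ [_ /(_ u su)]//|/(_ (2 *: (S - scatter x mu)))]; case; split.
  by rewrite /= linearZ/= linearB/= tr_scatter (spd_sym pS).
move=> v sv; rewrite derive_cov//= -!scalemxAl mxtraceZ mulrA mulVf// mul1r.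
have sI := tr_invmx pS.
rewrite mulmxBl mulmxV ?spd_unit// /fdot /gauss_cost_grad linearB/= !trmx_mul sI tr_scatter.
rewrite !mulmxBl mul1mx !raddfB/=; congr (_ - _).
  by rewrite mxtrace_mulC.
by rewrite mxtrace_mulC !mulmxA.
Qed.

End Problem.

(** * Stationarity gap after one step *)

Lemma gap_arith (R : realType) (l C k L a d y e : R) : l * y <= l * a ->
  - (C * (k * (L * d))) <= e -> 0 <= l * d -> 0 <= C * (k * L) * a ->
  - ((l + C * (k * L)) * (a + d)) <= - (l * y) + e.
Proof. by move=> h1 h2 h3 h4; lra. Qed.

Section Stationarity.
Context {R : realType} {N M : nat}.
Variables (x : 'I_M -> 'cV[R]_N) (rho1 rho2 lambda r0 : R).
Hypotheses (hcov : spd (emp_cov x)) (hrho1 : 0 < rho1) (hrho2 : 0 < rho2).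
Hypotheses (hlambda : 0 < lambda) (hr0 : 0 < r0).
Implicit Types (mu u v : 'cV[R]_N) (S : 'M[R]_N).

Let T := emp_cov x.
Let m := emp_mean x.
Let b := 2 * rho2 ^+ 2.

Let b_gt0 : 0 < b. Proof. by rewrite /b mulr_gt0// exprn_gt0. Qed.

Lemma Theta1E mu : Theta1 x rho1 mu <-> fnorm (mu - m) <= rho1.
Proof.
rewrite /Theta1/= -/(fdot (mu - m) (mu - m)) -sqr_fnorm.
by rewrite ler_pXn2r// ?nnegrE ?fnorm_ge0 ?(ltW hrho1).
Qed.

Lemma gdistE S S' : gdist (fisher_rao N) S S' = (Num.sqrt 2)^-1 * fnorm (logm (whiten S' S)).
Proof. by []. Qed.

Lemma Theta2E S : Theta2 x rho2 S <-> ball_spd T b S.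
Proof.
have s2 : 0 < Num.sqrt (2 : R) by rewrite sqrtr_gt0.
have E : (gdist (fisher_rao N) S T <= rho2) = (sqlog (whiten T S) <= b).
  rewrite gdistE ler_pdivrMl// /sqlog /b -[X in X * _ ^+ 2](@sqr_sqrtr _ 2)// -exprMn.
  by rewrite ler_pXn2r// ?nnegrE ?fnorm_ge0// mulr_ge0 ?(ltW s2) ?(ltW hrho2).
by rewrite /Theta2/= /ball_spd/= E.
Qed.

Lemma Theta2_spd S : Theta2 x rho2 S -> spd S. Proof. by case. Qed.

Lemma Theta1_segment mu u t : Theta1 x rho1 mu -> Theta1 x rho1 (mu + u) ->
  0 <= t -> t <= 1 -> Theta1 x rho1 (mu + t *: u).
Proof.
rewrite !Theta1E => h1 h2 t0 t1.
have -> : mu + t *: u - m = (1 - t) *: (mu - m) + t *: (mu + u - m).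
  rewrite ![mu + _ - m]addrAC; move: (mu - m) => w.
  by rewrite scalerDr addrA -scalerDl subrK scale1r.
apply: le_trans (fnormD _ _) _; rewrite !fnormZ (ger0_norm t0) ger0_norm ?subr_ge0//.
have -> : rho1 = (1 - t) * rho1 + t * rho1 by ring.
by apply: lerD; rewrite ler_wpM2l// subr_ge0.
Qed.

Lemma expm0 : expm (0 : 'M[R]_N) = 1%:M.
Proof.
have s0 : (0 : 'M[R]_N)^T = 0 by rewrite trmx0.
have e0 : fmx (fun=> 0) (0 : 'M[R]_N) = 0 by rewrite fmx_cst// raddf0.
transitivity (fmx (expR \o (fun=> 0)) (0 : 'M[R]_N)).
  by rewrite -fmx_comp// e0 expmE.
by rewrite -(fmx_cst 1 s0); apply: eq_fmx => i /=; rewrite expR0.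
Qed.

Lemma block_gap_le (V : normedModType R) (g : riemannian V) (Theta : set V)
    (h : V -> R) (y : V) (B : R) :
  Tstar g Theta r0 y 0 -> rnorm g y 0 <= 1 ->
  (forall u : V, Tstar g Theta r0 y u -> rnorm g y u <= 1 ->
     - B <= metric g y (rgrad g h y) ((Num.min r0 1)^-1 *: u)) ->
  block_gap g Theta r0 h y <= B.
Proof.
move=> T0 n0 hB; rewrite /block_gap lerNl; apply: lb_le_inf.
  by eexists; exists 0.
by move=> _ [u [Tu nu] <-]; exact: hB.
Qed.

Definition prox_step (p q : 'cV[R]_N * 'M[R]_N) :=
  argmin (Theta1 x rho1) (fun mu => objective x mu p.2
    + lambda / 2 * \tr ((mu - p.1)^T *m (mu - p.1))) q.1 /\
  argmin (Theta2 x rho2) (fun S => objective x q.1 S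
    + lambda / 4 * frob (logm (isqrtm p.2 *m S *m isqrtm p.2)) ^+ 2) q.2.

Definition step_size (p q : 'cV[R]_N * 'M[R]_N) :=
  fnorm (q.1 - p.1) + fnorm (logm (whiten p.2 q.2)).

(** The objective and the proximal term are quadratic in the mean and the ball is
    convex, so the condition is the derivative at 0 along the segment. *)
Lemma mean_first_order p q u : spd p.2 -> prox_step p q -> Theta1 x rho1 (q.1 + u) ->
  - (lambda * fdot (q.1 - p.1) u) <= fdot (dscatter x q.1 u) (invmx p.2).
Proof.
move=> pS [[q1 qmin] _] qu; rewrite lerNl -subr_ge0 opprK addrC.
apply: (@ge0_of_near _ _ (fdot (@qscatter R N M u) (invmx p.2) + lambda / 2 * fdot u u) 1) => //.
move=> t t0 t1; have := qmin _ (Theta1_segment q1 qu (ltW t0) t1).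
rewrite -subr_ge0 opprD addrACA (objective_mean_taylor x) -mulrBr.
have -> : \tr ((q.1 + t *: u - p.1)^T *m (q.1 + t *: u - p.1)) -
   \tr ((q.1 - p.1)^T *m (q.1 - p.1)) = t * (2 * fdot (q.1 - p.1) u) + t ^+ 2 * fdot u u.
  rewrite addrAC; move: (q.1 - p.1) => w.
  rewrite -!/(fdot _ _) fdotDl !fdotDr !fdotZl !fdotZr (fdotC u w); ring.
move=> h; rewrite -(pmulr_rge0 _ t0); move: h.
have -> // : t * fdot (dscatter x q.1 u) (invmx p.2) +
  t ^+ 2 * fdot (@qscatter R N M u) (invmx p.2) +
  lambda / 2 * (t * (2 * fdot (q.1 - p.1) u) + t ^+ 2 * fdot u u) =
  t * (fdot (dscatter x q.1 u) (invmx p.2) + lambda * fdot (q.1 - p.1) u +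
   (fdot (@qscatter R N M u) (invmx p.2) + lambda / 2 * fdot u u) * t).
by field.
Qed.

Lemma cov_first_order p q (u : 'M[R]_N) : spd p.2 -> prox_step p q -> u^T = u ->
  Theta2 x rho2 (Exp (fisher_rao N) q.2 u) ->
  - (lambda / 2 * fdot (logdiv (whiten p.2 q.2)) (whiten p.2 u))
    <= fdot (gauss_cost_grad (scatter x q.1) q.2) u.
Proof.
move=> pS [_ [q2 qmin]] su; rewrite Theta2E => qu; rewrite lerNl -subr_ge0 opprK addrC.
have := @prox_first_order _ _ T p.2 q.2 (scatter x q.1) u b (lambda / 4) b_gt0 _ hcov pS.
have l4 : 0 <= lambda / 4 by rewrite divr_ge0// ltW.
have min' S : ball_spd T b S ->
   gauss_cost (scatter x q.1) q.2 + lambda / 4 * sqlog (whiten p.2 q.2) <=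
   gauss_cost (scatter x q.1) S + lambda / 4 * sqlog (whiten p.2 S).
  by move=> /Theta2E; exact: qmin.
move=> /(_ l4 (proj1 (Theta2E _) q2) min' su qu); congr (_ <= _).
by field.
Qed.

Lemma fnorm_data : exists2 X, 0 <= X &
  forall mu, Theta1 x rho1 mu -> forall j, fnorm (x j - mu) <= X.
Proof.
exists (\sum_j fnorm (x j - m) + rho1).
  by rewrite addr_ge0 ?(ltW hrho1)// sumr_ge0// => j _; exact: fnorm_ge0.
move=> mu /Theta1E hmu j; have -> : x j - mu = (x j - m) - (mu - m).
  by rewrite opprB addrA subrK.
apply: le_trans (fnormB _ _) _; rewrite lerD// (bigD1 j)//= lerDl.
by apply: sumr_ge0 => i _; exact: fnorm_ge0.
Qed.

Lemma fnorm_dscatter : exists2 C, 0 <= C & forall mu u, Theta1 x rho1 mu ->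
  fnorm (dscatter x mu u) <= C * fnorm u.
Proof.
have [X X0 hX] := fnorm_data; exists (2 * X); first by rewrite mulr_ge0.
move=> mu u hmu; apply: fnorm_avg => [|j]; first by rewrite !mulr_ge0 ?fnorm_ge0.
rewrite fnormN; apply: le_trans (fnormD _ _) _.
have h1 : fnorm (u *m (x j - mu)^T) <= fnorm u * X.
  by apply: le_trans (fnormM _ _) _; rewrite ler_wpM2l ?fnorm_ge0 ?fnorm_tr ?hX.
have h2 : fnorm ((x j - mu) *m u^T) <= X * fnorm u.
  by apply: le_trans (fnormM _ _) _; rewrite fnorm_tr ler_wpM2r ?fnorm_ge0 ?hX.
lra.
Qed.

Lemma fnorm_scatter : exists2 C, 0 <= C & forall mu, Theta1 x rho1 mu ->
  fnorm (scatter x mu) <= C.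
Proof.
have [X X0 hX] := fnorm_data; exists (X * X); first by rewrite mulr_ge0.
move=> mu hmu; apply: fnorm_avg => [|j]; first by rewrite mulr_ge0.
by apply: le_trans (fnormM _ _) _; rewrite fnorm_tr ler_pM ?fnorm_ge0 ?hX.
Qed.

Lemma scatter_lipschitz : exists2 C, 0 <= C & forall mu mu', Theta1 x rho1 mu ->
  Theta1 x rho1 mu' -> fnorm (scatter x mu' - scatter x mu) <= C * fnorm (mu' - mu).
Proof.
have [C C0 hC] := fnorm_dscatter; exists (C + 2 * rho1).
  by rewrite addr_ge0 ?mulr_ge0 ?(ltW hrho1).
move=> mu mu' h h'; have -> : mu' = mu + (mu' - mu) by rewrite addrC subrK.
rewrite scatterD [mu + (mu' - mu)]addrC subrK; set v := mu' - mu.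
have -> : scatter x mu + dscatter x mu v + @qscatter R N M v - scatter x mu
    = dscatter x mu v + @qscatter R N M v by rewrite -(addrA (scatter x mu)) [LHS]addrC addKr.
apply: le_trans (fnormD _ _) _; rewrite [leRHS]mulrDl; apply: lerD; first exact: hC.
have v2 : fnorm v <= 2 * rho1.
  have -> : v = (mu' - m) - (mu - m) by rewrite opprB addrA subrK.
  move: h h' => /Theta1E h /Theta1E h'; apply: le_trans (fnormB _ _) _; lra.
apply: fnorm_avg => [|j]; first by rewrite !mulr_ge0 ?fnorm_ge0 ?(ltW hrho1).
apply: le_trans (fnormM _ _) _.
by rewrite fnorm_tr ler_wpM2r ?fnorm_ge0.
Qed.

Definition stationarity_gap (q : 'cV[R]_N * 'M[R]_N) :=
  block_gap (euclidean N) (Theta1 x rho1) r0 (fun mu => objective x mu q.2) q.1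
  + block_gap (fisher_rao N) (Theta2 x rho2) r0 (fun S => objective x q.1 S) q.2.

Let kappa := (Num.min r0 1)^-1.
Let kappa_gt0 : 0 < kappa. Proof. by rewrite invr_gt0 lt_min hr0 ltr01. Qed.

Lemma Theta2_pinched : exists2 c, 0 < c & forall S, Theta2 x rho2 S -> pinched c S.
Proof.
have [c c0 h] := ball_spd_pinched b hcov.
by exists c => // S /Theta2E; exact: h.
Qed.

Lemma step_cov_lipschitz : exists2 C, 0 <= C & forall S S',
  Theta2 x rho2 S -> Theta2 x rho2 S' ->
  fnorm (S' - S) <= C * fnorm (logm (whiten S S')).
Proof.
have [c c0 pc] := Theta2_pinched; have [c' c'0 wc] := @whiten_pinched R N c c0.
have cc : 0 < c + c' by exact: addr_gt0.
exists ((N%:R * Num.sqrt (c + c')) ^+ 2 * (c + c')).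
  by rewrite mulr_ge0 ?sqr_ge0// ltW.
move=> S S' hS hS'; apply: fnorm_sub_le_log => //.
  by apply: pinched_le (pc _ hS) => //; rewrite lerDl ltW.
by apply: pinched_le (wc _ _ (pc _ hS) (pc _ hS')) => //; rewrite lerDr ltW.
Qed.

(** The optimality condition of the mean is about the old covariance p.2, while
    the gap is about the new one, q.2: the Lipschitz bound on the inverse pays
    for the difference. *)
Lemma mean_gap_le : exists2 C, 0 <= C & forall p q,
  Theta2 x rho2 p.2 -> prox_step p q ->
  block_gap (euclidean N) (Theta1 x rho1) r0 (fun mu => objective x mu q.2) q.1
    <= C * step_size p q.
Proof.
have [c c0 pc] := Theta2_pinched; have [L L0 hL] := step_cov_lipschitz.
have [C C0 hC] := fnorm_dscatter.
have c20 : 0 <= c ^+ 2 by exact: sqr_ge0.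
exists (kappa * (lambda + C * (c ^+ 2 * L))).
  by apply: mulr_ge0; [exact: ltW|rewrite addr_ge0 ?mulr_ge0 ?(ltW hlambda) ?(ltW c0)].
move=> p q p2 st; have [[q1 _] [q2 _]] := st.
have pS := Theta2_spd p2; have qS := Theta2_spd q2.
apply: block_gap_le.
- split=> //; exists q.1 => //; split; first by rewrite /= addr0.
  by rewrite /= subrr mulmx0 mxtrace0 sqrtr0 divr_ge0 ?(ltW hr0).
- by rewrite /rnorm/= mulmx0 mxtrace0 sqrtr0.
move=> u [_ [y qu [Ey _]]] nu; rewrite -Ey /= in qu.
have nu1 : fnorm u <= 1 by [].
rewrite metric_rgrad_mean// dscatterZ fdotZl -/kappa -[X in - X]mulrA -mulrN ler_pM2l//.
have h1 := mean_first_order pS st qu.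
have h2 : `|fdot (q.1 - p.1) u| <= fnorm (q.1 - p.1).
  apply: le_trans (cauchy_schwarz _ _) _.
  by rewrite -[leRHS]mulr1 ler_wpM2l ?fnorm_ge0.
have h3 : `|fdot (dscatter x q.1 u) (invmx q.2 - invmx p.2)|
    <= C * (c ^+ 2 * (L * fnorm (logm (whiten p.2 q.2)))).
  apply: le_trans (cauchy_schwarz _ _) _; rewrite ler_pM ?fnorm_ge0//.
    apply: le_trans (hC _ _ q1) _.
    by rewrite -[leRHS]mulr1 ler_wpM2l.
  apply: le_trans (invmx_lipschitz c0 (pc _ p2) (pc _ q2)) _.
  by rewrite ler_wpM2l// hL.
have -> : fdot (dscatter x q.1 u) (invmx q.2) =
   fdot (dscatter x q.1 u) (invmx p.2) + fdot (dscatter x q.1 u) (invmx q.2 - invmx p.2).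
  by rewrite -fdotDr addrC subrK.
apply: le_trans (lerD h1 (lexx _)).
have h4 : lambda * fdot (q.1 - p.1) u <= lambda * fnorm (q.1 - p.1).
  by rewrite ler_wpM2l ?(ltW hlambda)//; apply: le_trans (ler_norm _) h2.
have h5 : 0 <= lambda * fnorm (logm (whiten p.2 q.2)).
  by rewrite mulr_ge0 ?fnorm_ge0 ?(ltW hlambda).
have h6 : 0 <= C * (c ^+ 2 * L) * fnorm (q.1 - p.1).
  by rewrite !mulr_ge0 ?fnorm_ge0 ?(ltW c0).
move: h3; rewrite ler_norml => /andP[h3 _].
exact: gap_arith h4 h3 h5 h6.
Qed.

(** Here the objective is the same in the optimality condition and in the gap;
    only the derivative of the proximal term remains, and it is bounded by the
    distance from p.2 to q.2. *)
Lemma cov_gap_le : exists2 C, 0 <= C & forall p q,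
  Theta2 x rho2 p.2 -> prox_step p q ->
  block_gap (fisher_rao N) (Theta2 x rho2) r0 (fun S => objective x q.1 S) q.2
    <= C * step_size p q.
Proof.
have [c c0 pc] := Theta2_pinched; have [c' c'0 wc] := @whiten_pinched R N c c0.
pose s := N%:R * Num.sqrt c; have s0 : 0 <= s by rewrite mulr_ge0 ?sqrtr_ge0.
pose k := lambda / 2 * ((N%:R * c') * (s ^+ 2 * (s * Num.sqrt 2 * s))).
have k0 : 0 <= k.
  rewrite /k mulr_ge0 ?divr_ge0 ?(ltW hlambda)//.
  by rewrite !mulr_ge0 ?sqrtr_ge0 ?sqr_ge0 ?ler0n ?(ltW c'0).
exists (kappa * k); first by apply: mulr_ge0 => //; exact: ltW.
move=> p q p2 st; have [[q1 _] [q2 _]] := st.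
have pS := Theta2_spd p2; have qS := Theta2_spd q2.
have Exp0 : Exp (fisher_rao N) q.2 0 = q.2.
  by rewrite /= mulmx0 mul0mx expm0 mulmx1 mul_sqrtm.
apply: block_gap_le.
- split; first by rewrite /= trmx0.
  exists q.2 => //; split=> //.
  by rewrite gdistE whiten_self// logm1 fnorm0 mulr0 divr_ge0 ?(ltW hr0).
- by rewrite /rnorm/= !mul0mx mxtrace0 mulr0 sqrtr0.
move=> u [su [y qu [Eu _]]] nu; rewrite /= in su; rewrite -Eu in qu.
rewrite metric_rgrad_cov//; last by rewrite linearZ/= su.
rewrite fdotZr -/kappa -[X in - X]mulrA -mulrN ler_pM2l//.
apply: le_trans (cov_first_order pS st su qu); rewrite lerN2.
(* The Fisher-Rao norm of u at q.2 is |whiten q.2 u| / sqrt 2. *)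
have nw : fnorm (whiten q.2 u) <= Num.sqrt 2.
  move: nu; rewrite /rnorm/=; set tt := \tr _ => nu.
  have tE : tt = fdot (whiten q.2 u) (whiten q.2 u).
    rewrite /fdot tr_whiten// /whiten /tt -(mul_isqrtm qS) !mulmxA.
    by rewrite [LHS]mxtrace_mulC !mulmxA.
  rewrite /fnorm -tE ler_sqrt//.
  have tt0 : 0 <= tt by rewrite tE fdot_ge0.
  have : 2^-1 * tt <= 1.
    rewrite -[leLHS](@sqr_sqrtr _ (2^-1 * tt)) ?mulr_ge0//.
    by rewrite expr_le1 ?sqrtr_ge0.
  by rewrite -ler_pdivlMl ?invr_gt0// invrK mulr1.
have fu : fnorm u <= s * Num.sqrt 2 * s.
  rewrite -(whitenK u qS); apply: fnorm_sandwich => //; apply: pinched_fnorm_sqrt => //;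
  exact: pc.
have fwu : fnorm (whiten p.2 u) <= s ^+ 2 * (s * Num.sqrt 2 * s).
  by apply: le_trans (fnorm_whiten _ c0 (pc _ p2)) _; rewrite ler_wpM2l ?sqr_ge0.
have pZ := wc _ _ (pc _ p2) (pc _ q2).
have fl : fnorm (logdiv (whiten p.2 q.2)) <= fnorm (logm (whiten p.2 q.2)) * (N%:R * c').
  apply: le_trans (fnormM _ _) _; rewrite ler_wpM2l ?fnorm_ge0//.
  exact: pinched_fnorm_inv.
have h : fdot (logdiv (whiten p.2 q.2)) (whiten p.2 u) <=
   fnorm (logm (whiten p.2 q.2)) * (N%:R * c') * (s ^+ 2 * (s * Num.sqrt 2 * s)).
  apply: le_trans (ler_norm _) _; apply: le_trans (cauchy_schwarz _ _) _.
  by rewrite ler_pM ?fnorm_ge0.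
apply: le_trans (_ : k * fnorm (logm (whiten p.2 q.2)) <= _); last first.
  by rewrite ler_wpM2l// lerDr fnorm_ge0.
rewrite /k -(mulrA (lambda / 2)) ler_wpM2l ?divr_ge0 ?(ltW hlambda)//.
by apply: le_trans h _; rewrite le_eqVlt; apply/orP; left; apply/eqP; ring.
Qed.

Lemma stationarity_gap_le : exists2 C, 0 <= C & forall p q,
  Theta2 x rho2 p.2 -> prox_step p q -> stationarity_gap q <= C * step_size p q.
Proof.
have [C1 C10 h1] := mean_gap_le; have [C2 C20 h2] := cov_gap_le.
exists (C1 + C2); first exact: addr_ge0.
by move=> p q p2 st; rewrite mulrDl lerD ?h1 ?h2.
Qed.

End Stationarity.

(** * Descent and complexity *)

Section Convergence.
Context {R : realType} {N M : nat}.
Variables (x : 'I_M -> 'cV[R]_N) (rho1 rho2 lambda r0 : R).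
Hypotheses (hcov : spd (emp_cov x)) (hrho1 : 0 < rho1) (hrho2 : 0 < rho2).
Hypotheses (hlambda : 0 < lambda) (hr0 : 0 < r0).
Implicit Types (p q : 'cV[R]_N * 'M[R]_N) (theta : nat -> 'cV[R]_N * 'M[R]_N).

Let Theta : set ('cV[R]_N * 'M[R]_N) := Theta1 x rho1 `*` Theta2 x rho2.
Let f p := objective x p.1 p.2.

Lemma iterates_Theta theta : iterates x rho1 rho2 lambda theta -> forall n, Theta (theta n).
Proof.
move=> [t0 st] [|n] //; have [[h1 _] [h2 _]] := st n; split => //.
Qed.

Lemma iterates_step theta n : iterates x rho1 rho2 lambda theta ->
  prox_step x rho1 rho2 lambda (theta n) (theta n.+1).
Proof. by move=> [_ st]; exact: st. Qed.

Lemma objective_bounded : exists2 B, 0 <= B & forall p, Theta p -> `|f p| <= B.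
Proof.
have [c c0 pc] := Theta2_pinched hcov hrho2; have [A A0 hA] := fnorm_scatter x hrho1.
exists (A * (N%:R * c) + fnorm (1%:M : 'M[R]_N) * (N%:R * c)).
  by rewrite addr_ge0 ?mulr_ge0 ?fnorm_ge0 ?ler0n ?(ltW c0).
move=> p [p1 p2]; have pp := pc _ p2; have sp := Theta2_spd p2.
rewrite /f objectiveE /gauss_cost ln_det//; apply: le_trans (ler_normD _ _) _; apply: lerD.
  apply: le_trans (cauchy_schwarz _ _) _.
  by rewrite ler_pM ?fnorm_ge0 ?hA ?pinched_fnorm_inv.
rewrite -[logm _]mul1mx; apply: le_trans (abs_trace_mul _ _) _.
by rewrite ler_wpM2l ?fnorm_ge0 ?pinched_fnorm_log.
Qed.

Definition step_energy p q :=
  lambda / 2 * fnorm (q.1 - p.1) ^+ 2 + lambda / 4 * fnorm (logm (whiten p.2 q.2)) ^+ 2.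

Lemma step_energy_ge0 p q : 0 <= step_energy p q.
Proof. by rewrite addr_ge0 ?mulr_ge0 ?invr_ge0 ?sqr_ge0 ?fnorm_ge0 ?(ltW hlambda). Qed.

(** Compare the new mean with the old one, then the new covariance with the old
    one. *)
Lemma descent p q : Theta p -> prox_step x rho1 rho2 lambda p q ->
  f q + step_energy p q <= f p.
Proof.
move=> [p1 p2] [[q1 h1] [q2 h2]]; have pS := Theta2_spd p2.
have e2 : frob (logm (isqrtm p.2 *m p.2 *m isqrtm p.2)) = 0.
  rewrite -[_ *m _ *m _]/(whiten p.2 p.2) whiten_self// logm1.
  exact: (@fnorm0 R).
have := h1 _ p1; have := h2 _ p2; rewrite e2 expr0n/= mulr0 addr0.
rewrite subrr mulmx0 mxtrace0 mulr0 addr0 => h3 h4.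
rewrite /f /step_energy sqr_fnorm; apply: le_trans h4.
by rewrite addrA addrAC lerD2r.
Qed.

Lemma step_size_sqr p q : step_size p q ^+ 2 <= 8 / lambda * step_energy p q.
Proof.
rewrite /step_size /step_energy; move: (fnorm _) (fnorm _) => a d.
rewrite -subr_ge0 [leRHS](_ : _ = (a - d) ^+ 2 + 2 * d ^+ 2); last first.
  by field; rewrite gt_eqF.
by rewrite addr_ge0 ?sqr_ge0// mulr_ge0 ?sqr_ge0.
Qed.

Lemma sum_energy : exists2 E, 0 <= E & forall theta, iterates x rho1 rho2 lambda theta ->
  forall n, \sum_(i < n) step_energy (theta i) (theta i.+1) <= E.
Proof.
have [B B0 hB] := objective_bounded; exists (2 * B); first by rewrite mulr_ge0.
move=> theta it n.
have h k : \sum_(i < k) step_energy (theta i) (theta i.+1) <= f (theta 0%N) - f (theta k).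
  elim: k => [|k IHk]; first by rewrite big_ord0 subrr.
  rewrite big_ord_recr/=.
  have := descent (iterates_Theta it k) (iterates_step k it); lra.
apply: le_trans (h n) _.
have := hB _ (iterates_Theta it 0%N); have := hB _ (iterates_Theta it n).
rewrite !ler_norml => /andP[h1 h2] /andP[h3 h4]; lra.
Qed.

Lemma stationary_of_gap q eps : Theta q -> stationarity_gap x rho1 rho2 r0 q <= eps ->
  eps_stationary_pt x rho1 rho2 r0 eps q.
Proof. by []. Qed.

(** If the first K gaps were all larger than eps, then K eps^2 would be at most
    C^2 times the sum of the squared step sizes, which is bounded. *)
Lemma complexity_bound : soft_bigO (complexity x rho1 rho2 lambda r0) (fun eps => eps ^- 2).
Proof.
have [E E0 hE] := sum_energy.
have [C C0 hC] := stationarity_gap_le hcov hrho1 hrho2 hlambda hr0.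
pose Q := C ^+ 2 * (8 / lambda * E).
have Q0 : 0 <= Q.
  by rewrite /Q mulr_ge0 ?sqr_ge0// mulr_ge0// divr_ge0// ltW.
(* The exponent 0 says that there is no logarithmic factor. *)
exists (Q + 1), 0%N; near=> eps.
have e0 : 0 < eps by [].
have e1 : eps <= 1 by near: eps; exact: nbhs_right_le.
rewrite expr0 mulr1; apply: ge_ereal_sup => _ [theta it <-].
(* The least K such that K eps^2 exceeds the bound Q. *)
pose K := (Num.truncn (Q / eps ^+ 2)).+1.
have KQ : Q / eps ^+ 2 < K%:R by rewrite truncnS_gt.
have K1 : K%:R <= (Q + 1) * eps ^- 2.
  rewrite /K -natr1 mulrDl mul1r lerD//.
    by rewrite truncn_le divr_ge0 ?sqr_ge0.
  by rewrite invf_ge1 ?exprn_gt0// expr_le1// ltW.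
have [n [nK hn]] : exists n, (n < K)%N /\ stationarity_gap x rho1 rho2 r0 (theta n.+1) <= eps.
  apply: contrapT => /forallNP hno.
  have big n : (n < K)%N -> eps ^+ 2 <= C ^+ 2 * (8 / lambda * step_energy (theta n) (theta n.+1)).
    move=> nK; have := hno n; rewrite not_andP => -[//|/negP].
    rewrite -ltNge => hlt.
    have [_ t2] := iterates_Theta it n.
    have := lt_le_trans hlt (hC _ _ t2 (iterates_step n it)) => h.
    apply: le_trans (_ : (C * step_size (theta n) (theta n.+1)) ^+ 2 <= _).
      by rewrite lerXn2r ?nnegrE ?ltW// (lt_trans e0).
    by rewrite exprMn ler_wpM2l ?sqr_ge0 ?step_size_sqr.
  have : K%:R * eps ^+ 2 <= Q.
    rewrite mulr_natl -[X in _ *+ X]card_ord -sumr_const.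
    apply: (@le_trans _ _ (\sum_(i < K) C ^+ 2 * (8 / lambda * step_energy (theta i) (theta i.+1)))).
      by apply: ler_sum => i _; apply: big; exact: ltn_ord.
    by rewrite -!mulr_sumr ler_wpM2l ?sqr_ge0// ler_wpM2l ?divr_ge0 ?(ltW hlambda)// hE.
  by rewrite leNgt -ltr_pdivrMr ?exprn_gt0// KQ.
apply: (@le_trans _ _ K%:R%:E); last by rewrite lee_fin.
apply: (@le_trans _ _ n.+1%:R%:E); last by rewrite lee_fin ler_nat.
apply: ereal_inf_lbound; exists n.+1 => //; split => //.
by apply: stationary_of_gap => //; exact: iterates_Theta.
Unshelve. all: by end_near.
Qed.

(** The objective is nonincreasing and bounded below, so its decrements become
    small. *)
Lemma small_steps theta e : iterates x rho1 rho2 lambda theta -> 0 < e ->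
  exists n0, forall n, (n0 <= n)%N -> step_size (theta n) (theta n.+1) <= e.
Proof.
move=> it e0; have [B B0 hB] := objective_bounded.
have dec n : f (theta n.+1) <= f (theta n).
  have := descent (iterates_Theta it n) (iterates_step n it).
  have := step_energy_ge0 (theta n) (theta n.+1); lra.
have dec' n k : f (theta (n + k)%N) <= f (theta n).
  elim: k => [|k IHk]; first by rewrite addn0.
  by rewrite addnS; exact: le_trans (dec _) IHk.
have lb : has_inf (range (f \o theta)).
  split; first by exists (f (theta 0%N)); exists 0%N.
  exists (- B) => _ [n _ <-] /=; have := hB _ (iterates_Theta it n).
  by rewrite ler_norml => /andP[].
have d0 : 0 < lambda / 8 * e ^+ 2 by rewrite mulr_gt0 ?divr_gt0 ?exprn_gt0.
have [_ [n0 _ <-] hn0] := inf_adherent d0 lb.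
exists n0 => n n0n; have hn := descent (iterates_Theta it n) (iterates_step n it).
have h1 : inf (range (f \o theta)) <= f (theta n.+1).
  by apply: ge_inf; [case: lb|exists n.+1].
have h2 : f (theta n) <= f (theta n0) by rewrite -(subnKC n0n).
have h3 : step_energy (theta n) (theta n.+1) <= lambda / 8 * e ^+ 2.
  by rewrite /= in hn0; lra.
rewrite -(@ler_pXn2r _ 2) ?nnegrE ?(ltW e0) ?addr_ge0 ?fnorm_ge0//.
apply: le_trans (step_size_sqr _ _) _.
have -> : e ^+ 2 = 8 / lambda * (lambda / 8 * e ^+ 2) by field; rewrite gt_eqF.
by rewrite ler_wpM2l// divr_ge0// ltW.
Qed.

Lemma fnorm_le_entries m n (A : 'M[R]_(m, n)) e : 0 <= e ->
  (forall i j, `|A i j| <= e) -> fnorm A <= (m * n)%:R * e.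
Proof.
move=> e0 Ae; rewrite -(@ler_pXn2r _ 2) ?nnegrE ?fnorm_ge0 ?mulr_ge0//.
rewrite sqr_fnorm fdotE.
apply: (@le_trans _ _ (\sum_(i < m) \sum_(j < n) e ^+ 2)).
  apply: ler_sum => i _; apply: ler_sum => j _.
  by rewrite -expr2 -real_normK ?num_real// lerXn2r ?nnegrE.
rewrite !sumr_const !card_ord -mulrnA -[_ *+ _]mulr_natl mulnC exprMn.
rewrite ler_wpM2r ?sqr_ge0// -natrX ler_nat.
by case: (m * n)%N => // k; rewrite leq_pmulr.
Qed.

Lemma cluster_near theta p e n0 : cluster (theta @ \oo) p -> 0 < e ->
  exists n, [/\ (n0 <= n)%N, fnorm ((theta n).1 - p.1) <= e & fnorm ((theta n).2 - p.2) <= e].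
Proof.
move=> cp e0; pose d := e / ((N * 1)%:R + (N * N)%:R + 1).
have k0 : 0 < (N * 1)%:R + (N * N)%:R + 1 :> R by rewrite ltr_wpDl// addr_ge0.
have d0 : 0 < d by rewrite divr_gt0.
have [_ [[n n0n <-] [b1 b2]]] := cp [set theta n | n in [set n | (n0 <= n)%N]] (ball p d)
  ltac:(by exists n0 => // n /= hn; exists n) ltac:(exact: nbhsx_ballx).
have small m k : (m * k)%:R <= (N * 1)%:R + (N * N)%:R + 1 :> R -> (m * k)%:R * d <= e.
  by move=> h; rewrite /d mulrCA ler_piMr ?(ltW e0)// ler_pdivrMr// mul1r.
exists n; split => //.
  apply: le_trans (fnorm_le_entries (ltW d0) _) _; last first.
    by apply: small; rewrite -addrA lerDl addr_ge0.
  move=> i j; have [_ /(_ i j)] := b1; rewrite /ball/= => h.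
  by rewrite !mxE distrC ltW.
apply: le_trans (fnorm_le_entries (ltW d0) _) _; last first.
  by apply: small; rewrite addrAC lerDr addr_ge0.
move=> i j; have [_ /(_ i j)] := b2; rewrite /ball/= => h.
by rewrite !mxE distrC ltW.
Qed.

(** Near a limit point there are an iterate and its predecessor, because the
    steps become small. *)
Lemma cluster_approx theta p e : iterates x rho1 rho2 lambda theta ->
  cluster (theta @ \oo) p -> 0 < e ->
  exists r q, [/\ Theta r, Theta q, prox_step x rho1 rho2 lambda r q,
    fnorm (q.1 - p.1) <= e /\ fnorm (q.2 - p.2) <= e &
    fnorm (r.1 - p.1) <= e /\ fnorm (r.2 - p.2) <= e].
Proof.
move=> it cp e0; have [C C0 hC] := step_cov_lipschitz hcov hrho2.
(* The predecessor is within (C + 1) d of the iterate, and the iterate within d of p. *)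
pose d := e / (C + 2); have d0 : 0 < d by rewrite divr_gt0// ltr_wpDl.
have dE : d * (C + 2) = e by rewrite mulfVK// gt_eqF// ltr_wpDl.
have Cd0 : 0 <= C * d by rewrite mulr_ge0// ltW.
have [n0 hn0] := small_steps it d0.
have [[|n] [// n0n h1 h2]] := cluster_near n0.+1 cp d0.
have t0 := iterates_Theta it n; have t1 := iterates_Theta it n.+1.
exists (theta n), (theta n.+1); split => //.
- exact: iterates_step.
- have dE' : C * d + d * 2 = e by rewrite mulrC -mulrDr.
  by split; [apply: le_trans h1 _|apply: le_trans h2 _]; lra.
have := hn0 _ n0n; rewrite /step_size => hs.
have p1 := fnorm_ge0 ((theta n.+1).1 - (theta n).1).
have p2 := fnorm_ge0 (logm (whiten (theta n).2 (theta n.+1).2)).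
have h3 : fnorm ((theta n.+1).2 - (theta n).2) <= C * d.
  by apply: le_trans (hC _ _ t0.2 t1.2) _; rewrite ler_wpM2l//; lra.
have tri m (a b c : 'M[R]_(N, m)) : fnorm (a - c) <= fnorm (b - a) + fnorm (b - c).
  have -> : a - c = - (b - a) + (b - c) by rewrite opprB addrA subrK.
  by apply: le_trans (fnormD _ _) _; rewrite fnormN.
have dE' : C * d + d * 2 = e by rewrite mulrC -mulrDr.
by split; [apply: le_trans (tri _ _ (theta n.+1).1 _) _|
           apply: le_trans (tri _ _ (theta n.+1).2 _) _]; lra.
Qed.

End Convergence.

(** * Limit points *)

Section ClusterPoints.
Context {R : realType} {N M : nat}.
Implicit Types (S T A P : 'M[R]_N).

Lemma le_of_le_adde (a b K : R) : (forall e, 0 < e -> a <= b + K * e) -> a <= b.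
Proof.
move=> h; rewrite -subr_ge0; apply: (@ge0_of_near _ _ K 1) => // t t0 _.
by rewrite addrAC subr_ge0 h.
Qed.

Lemma pinched_closed c P : 0 < c ->
  (forall e, 0 < e -> exists S, pinched c S /\ fnorm (S - P) <= e) ->
  pinched ((N%:R + 1) * c) P.
Proof.
move=> c0 hP.
have sP : P^T = P.
  apply/esym/eqP; rewrite -subr_eq0; apply/eqP/fdot_eq0.
  rewrite -sqr_fnorm; apply/eqP; rewrite sqrf_eq0 eq_le fnorm_ge0 andbT.
  apply: (@le_of_le_adde _ _ 2) => e e0; have [S [[sS _] hS]] := hP e e0.
  have -> : P - P^T = (S - P)^T - (S - P).
    by rewrite [(S - P)^T]linearB/= sS opprB [RHS]addrC addrA subrK.
  apply: le_trans (fnormB _ _) _; rewrite fnorm_tr; lra.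
apply: (@pinched_of_quad _ _ c^-1) => //.
- by rewrite invr_gt0.
- by rewrite invrK mulrDl mul1r lerDr mulr_ge0// ltW.
- move=> v; apply: (@le_of_le_adde _ _ (fdot v v)) => e e0.
  have [S [[sS bS] hS]] := hP e e0.
  have h1 : c^-1 * fdot v v <= \tr (v^T *m S *m v).
    by apply: quad_ge => // i; have /andP[] := bS i.
  have -> : \tr (v^T *m P *m v) = \tr (v^T *m S *m v) - \tr (v^T *m (S - P) *m v).
    by rewrite mulmxBr mulmxBl [\tr (_ - _)]raddfB/= opprB addrC subrK.
  have h2 : `|\tr (v^T *m (S - P) *m v)| <= e * fdot v v.
    by apply: le_trans (quad_abs_le _ _) _; rewrite ler_wpM2r ?fdot_ge0.
  move: h2; rewrite ler_norml => /andP[_ h2]; rewrite [fdot v v * e]mulrC; lra.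
- apply: (@le_of_le_adde _ _ 1) => e e0; have [S [pS hS]] := hP e e0.
  have h := pinched_fnorm c0 pS; rewrite mulrDl !mul1r.
  have -> : P = S - (S - P) by rewrite opprB addrC subrK.
  apply: le_trans (fnormB _ _) _; lra.
Qed.

Lemma sqlog_whiten_lipschitz (c : R) : 0 < c -> exists2 K, 0 <= K & forall T T' S S' : 'M[R]_N,
  pinched c T -> pinched c T' -> pinched c S -> pinched c S' ->
  `|sqlog (whiten T S) - sqlog (whiten T' S')| <= K * (fnorm (T - T') + fnorm (S - S')).
Proof.
move=> c0; have [c' c'0 wc] := @whiten_pinched R N c c0.
have [L L0 hL] := @whiten_lipschitz R N c c0.
exists (2 * N%:R * c' ^+ 2 * L); first by rewrite !mulr_ge0 ?ler0n ?(ltW c'0).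
move=> T T' S S' pT pT' pS pS'.
apply: le_trans (sqlog_lipschitz c'0 (wc _ _ pT' pS') (wc _ _ pT pS)) _.
rewrite -[leRHS]mulrA ler_wpM2l ?hL//.
by rewrite !mulr_ge0 ?ler0n ?(ltW c'0).
Qed.

Variables (x : 'I_M -> 'cV[R]_N) (rho1 rho2 lambda : R).
Hypotheses (hcov : spd (emp_cov x)) (hrho1 : 0 < rho1) (hrho2 : 0 < rho2).
Hypothesis (hlambda : 0 < lambda).
Variable p : 'cV[R]_N * 'M[R]_N.

Hypothesis approx : forall e, 0 < e -> exists r q,
  [/\ (Theta1 x rho1 `*` Theta2 x rho2) r, (Theta1 x rho1 `*` Theta2 x rho2) q,
    prox_step x rho1 rho2 lambda r q,
    fnorm (q.1 - p.1) <= e /\ fnorm (q.2 - p.2) <= e &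
    fnorm (r.1 - p.1) <= e /\ fnorm (r.2 - p.2) <= e].

Lemma limit_pinched : exists c, [/\ 0 < c, pinched c p.2 &
  forall S, Theta2 x rho2 S -> pinched c S].
Proof.
have [c c0 pc] := Theta2_pinched hcov hrho2.
exists ((N%:R + 1) * c); split.
- by rewrite mulr_gt0// ltr_wpDl.
- apply: pinched_closed => // e e0; have [r [q [[_ r2] _ _ _ [_ h]]]] := approx e0.
  by exists r.2; split => //; exact: pc.
- move=> S hS; apply: pinched_le (pc _ hS) => //.
  by rewrite mulrDl mul1r lerDr mulr_ge0// ltW.
Qed.

Lemma limit_Theta : (Theta1 x rho1 `*` Theta2 x rho2) p.
Proof.
split.
  apply/(Theta1E x hrho1); apply: (@le_of_le_adde _ _ 1) => e e0.
  have [r [q [[/(Theta1E x hrho1) r1 _] _ _ _ [h _]]]] := approx e0.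
  have -> : p.1 - emp_mean x = (r.1 - emp_mean x) - (r.1 - p.1).
    by rewrite opprB [RHS]addrC addrA subrK.
  apply: le_trans (fnormB _ _) _; lra.
have [c [c0 pp pc]] := limit_pinched.
have [k k0 pT] := spd_pinched hcov.
have ck : 0 < c + k by exact: addr_gt0.
have mono A : pinched c A -> pinched (c + k) A.
  by move=> h; apply: pinched_le h => //; rewrite lerDl ltW.
have pT' : pinched (c + k) (emp_cov x) by apply: pinched_le pT => //; rewrite lerDr ltW.
have [K K0 hK] := @sqlog_whiten_lipschitz (c + k) ck.
apply/(Theta2E x hrho2); split; first exact: pinched_spd pp.
apply: (@le_of_le_adde _ _ K) => e e0.
have [r [q [[_ r2] _ _ _ [_ h]]]] := approx e0.
have := hK _ _ _ _ pT' pT' (mono _ pp) (mono _ (pc _ r2)).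
rewrite subrr fnorm0 add0r -fnormN opprB => h1.
have h2 : K * fnorm (r.2 - p.2) <= K * e by rewrite ler_wpM2l.
have [_ h3] := proj1 (Theta2E x hrho2 r.2) r2.
by have := le_trans (ler_norm _) h1; lra.
Qed.

(** Each side of the two minimality inequalities is Lipschitz in the iterates on
    the feasible set, so the inequalities at (r, q) hold at (p, p) up to a
    multiple of e, and e is arbitrary. *)
Lemma limit_prox_step : prox_step x rho1 rho2 lambda p p.
Proof.
have [p1 p2] := limit_Theta.
have [c [c0 pp pc]] := limit_pinched.
have [A A0 hA] := fnorm_scatter x hrho1.
have [L L0 hL] := scatter_lipschitz x hrho1.
have [K K0 hK] := @sqlog_whiten_lipschitz c c0.
pose g := A * c ^+ 2 + fnorm (1%:M : 'M[R]_N) * c.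
have g0 : 0 <= g by rewrite /g addr_ge0 ?mulr_ge0 ?fnorm_ge0 ?(ltW c0).
have nc : 0 <= N%:R * c by rewrite mulr_ge0 ?ler0n ?ltW.
have gS mu S S' e : Theta1 x rho1 mu -> pinched c S -> pinched c S' ->
    fnorm (S - S') <= e -> `|gauss_cost (scatter x mu) S - gauss_cost (scatter x mu) S'| <= g * e.
  move=> hmu pS pS' hS; apply: le_trans (gauss_cost_lipschitz _ c0 pS pS') _.
  apply: ler_pM => //; rewrite ?addr_ge0 ?mulr_ge0 ?fnorm_ge0 ?(ltW c0)//.
  by rewrite lerD2r ler_wpM2r ?sqr_ge0 ?hA.
have gmu mu mu' S e : Theta1 x rho1 mu -> Theta1 x rho1 mu' -> pinched c S ->
    fnorm (mu - mu') <= e ->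
    `|gauss_cost (scatter x mu) S - gauss_cost (scatter x mu') S| <= N%:R * c * (L * e).
  move=> h h' pS hmu; apply: le_trans (gauss_cost_lipschitz_data _ _ c0 pS) _.
  rewrite ler_wpM2l//; apply: le_trans (hL _ _ h' h) _; exact: ler_wpM2l.
split; split=> //.
- move=> mu hmu; rewrite subrr mulmx0 mxtrace0 mulr0 addr0 !objectiveE -/(fdot _ _).
  pose k := lambda / 2 * (4 * rho1 + 4 * rho1).
  have l2 : 0 <= lambda / 2 by rewrite divr_ge0// ltW.
  apply: (@le_of_le_adde _ _ (g + N%:R * c * L + g + k)) => e e0.
  have [r [q [[r1 r2] [q1 q2] [[_ qmin] _] [hq1 hq2] [hr1 hr2]]]] := approx e0.
  have := qmin _ hmu; rewrite -!/(fdot _ _) !objectiveE => h.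
  have h0 : 0 <= lambda / 2 * fdot (q.1 - r.1) (q.1 - r.1) by rewrite mulr_ge0 ?fdot_ge0.
  have h1 := gS _ _ _ _ hmu (pc _ r2) pp hr2.
  have h2 := gS _ _ _ _ q1 (pc _ r2) pp hr2.
  have h3 := gmu _ _ _ _ q1 p1 pp hq1.
  have d1 nu : Theta1 x rho1 nu -> fnorm (mu - nu) <= 2 * rho1.
    move=> /(Theta1E x hrho1) h'; move/(Theta1E x hrho1): hmu => h''.
    have -> : mu - nu = (mu - emp_mean x) - (nu - emp_mean x).
      by rewrite opprB addrA subrK.
    apply: le_trans (fnormB _ _) _; lra.
  have h4 : fdot (mu - r.1) (mu - r.1) - fdot (mu - p.1) (mu - p.1) <= e * (4 * rho1).
    have -> : fdot (mu - r.1) (mu - r.1) - fdot (mu - p.1) (mu - p.1) =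
        fdot ((mu - r.1) - (mu - p.1)) ((mu - r.1) + (mu - p.1)).
      move: (mu - r.1) (mu - p.1) => a d.
      by rewrite fdotBl !fdotDr (fdotC d a); ring.
    apply: le_trans (ler_norm _) _; apply: le_trans (cauchy_schwarz _ _) _.
    apply: ler_pM; rewrite ?fnorm_ge0//.
      rewrite (_ : mu - r.1 - (mu - p.1) = - (r.1 - p.1)) ?fnormN//.
      by rewrite opprB [RHS]opprB addrC addrA subrK.
    apply: le_trans (fnormD _ _) _; have := d1 _ r1; have := d1 _ p1; lra.
  have h5 : lambda / 2 * fdot (mu - r.1) (mu - r.1) <=
     lambda / 2 * fdot (mu - p.1) (mu - p.1) + k * e.
    have -> : k * e = lambda / 2 * (e * (4 * rho1)) + lambda / 2 * (e * (4 * rho1)).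
      by rewrite /k; ring.
    have := ler_wpM2l l2 h4; rewrite mulrBr.
    have : 0 <= lambda / 2 * (e * (4 * rho1)) by rewrite !mulr_ge0// ltW.
    lra.
  move: h1 h2 h3; rewrite !ler_norml => /andP[_ h1] /andP[h2 _] /andP[h3 _].
  have -> : (g + N%:R * c * L + g + k) * e =
     g * e + N%:R * c * (L * e) + g * e + k * e by ring.
  lra.
have pS := Theta2_spd p2.
move=> S hS; rewrite !objectiveE -!/(whiten _ _) -!/(fnorm _) -!/(sqlog _).
rewrite whiten_self// sqlog1 mulr0 addr0.
have l4 : 0 <= lambda / 4 by rewrite divr_ge0// ltW.
apply: (@le_of_le_adde _ _ (g + N%:R * c * L + N%:R * c * L + lambda / 4 * K)) => e e0.
have [r [q [[r1 r2] [q1 q2] [_ [_ qmin]] [hq1 hq2] [hr1 hr2]]]] := approx e0.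
have := qmin _ hS; rewrite !objectiveE -!/(whiten _ _) -!/(fnorm _) -!/(sqlog _) => h.
have h0 : 0 <= lambda / 4 * sqlog (whiten r.2 q.2) by rewrite mulr_ge0 ?sqr_ge0.
have h1 := gmu _ _ _ _ q1 p1 (pc _ hS) hq1.
have h2 := gmu _ _ _ _ q1 p1 pp hq1.
have h3 := gS _ _ _ _ q1 (pc _ q2) pp hq2.
have h4 := hK _ _ _ _ (pc _ r2) pp (pc _ hS) (pc _ hS).
rewrite subrr fnorm0 addr0 in h4.
have h5 : lambda / 4 * (sqlog (whiten r.2 S) - sqlog (whiten p.2 S)) <= lambda / 4 * (K * e).
  rewrite ler_wpM2l//; apply: le_trans (ler_norm _) _; apply: le_trans h4 _.
  by rewrite ler_wpM2l.
rewrite mulrBr in h5.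
move: h1 h2 h3; rewrite !ler_norml => /andP[_ h1] /andP[h2 _] /andP[h3 _].
have -> : (g + N%:R * c * L + N%:R * c * L + lambda / 4 * K) * e =
   g * e + N%:R * c * (L * e) + N%:R * c * (L * e) + lambda / 4 * (K * e) by ring.
lra.
Qed.

End ClusterPoints.

Theorem corollary5p2 (R : realType) (N M : nat) (x : 'I_M -> 'cV[R]_N)
    (rho1 rho2 lambda r0 : R)
    (hcov : spd (emp_cov x))
    (hrho1 : 0 < rho1) (hrho2 : 0 < rho2) (hlambda : 0 < lambda)
    (hr0 : 0 < r0) :
  (forall theta : nat -> 'cV[R]_N * 'M[R]_N,
      iterates x rho1 rho2 lambda theta ->
      cluster (theta @ \oo) `<=` eps_stationary_pt x rho1 rho2 r0 0) /\
  soft_bigO (complexity x rho1 rho2 lambda r0) (fun eps => eps ^- 2).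
Proof.
split; last exact: complexity_bound.
move=> theta it p cp.
have approx e := @cluster_approx R N M x rho1 rho2 lambda hcov hrho1 hrho2 hlambda theta p e it cp.
have pT := limit_Theta hcov hrho1 hrho2 approx.
have st := limit_prox_step hcov hrho1 hrho2 hlambda approx.
have [C C0 hC] := stationarity_gap_le hcov hrho1 hrho2 hlambda hr0.
have size0 : step_size p p = 0.
  have pS := Theta2_spd pT.2.
  by rewrite /step_size subrr whiten_self// logm1 !fnorm0 addr0.
by apply: stationary_of_gap => //; have := hC _ _ pT.2 st; rewrite size0 mulr0.
Qed.
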